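(* Let $d\ge2$ be a positive integer and $a\in(l_0(\mathbb{Z}))^{r\times r}$ a finitely supported matrix-valued filter. Let $\phi$ be an $r\times1$ vector of compactly supported distributions satisfying $\widehat{\phi}(d\xi)=\widehat{a}(\xi)\widehat{\phi}(\xi)$ with $\widehat{\phi}(0)\ne0$. Suppose that $a$ has $m$ sum rules with respect to $d$ with a matching filter $\upsilon\in(l_0(\mathbb{Z}))^{1\times r}$ and $\widehat{\upsilon}(0)\widehat{\phi}(0)=1$. If the multiplicity $r\ge2$, then for any positive integer $n$ there exists a strongly invertible $r\times r$ matrix $\widehat{U}$ of $2\pi$-periodic trigonometric polynomials such that the following properties hold: (i) $\widehat{\mathring{a}}(\xi):=\widehat{U}(d\xi)\widehat{a}(\xi)\widehat{U}(\xi)^{-1}$ takes the form $$\begin{bmatrix}(1+e^{-i\xi}+\cdots+e^{-i(d-1)\xi})^mP_{1,1}(\xi)&(1-e^{-id\xi})^mP_{1,2}(\xi)\\(1-e^{-i\xi})^nP_{2,1}(\xi)&P_{2,2}(\xi)\end{bmatrix}$$ with $$\widehat{\mathring{a}_{1,1}}(\xi):=(1+e^{-i\xi}+\cdots+e^{-i(d-1)\xi})^mP_{1,1}(\xi)=1+\mathscr{O}(|\xi|^n),\quad\xi\to0,$$ where $P_{1,1},P_{1,2},P_{2,1},P_{2,2}$ are some $1\times1$, $1\times(r-1)$, $(r-1)\times1$ and $(r-1)\times(r-1)$ matrices of $2\pi$-periodic trigonometric polynomials. Moreover, defining $\widehat{\mathring{\upsilon}}(\xi):=[\widehat{\mathring{\upsilon}_1}(\xi),\ldots,\widehat{\mathring{\upsilon}_r}(\xi)]:=\widehat{\upsilon}(\xi)\widehat{U}(\xi)^{-1}$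 and $\widehat{\mathring{\phi}}(\xi):=[\widehat{\mathring{\phi}_1}(\xi),\ldots,\widehat{\mathring{\phi}_r}(\xi)]^{\mathsf T}:=\widehat{U}(\xi)\widehat{\phi}(\xi)$, we have $\widehat{\mathring{\phi}}(d\xi)=\widehat{\mathring{a}}(\xi)\widehat{\mathring{\phi}}(\xi)$ with $$\widehat{\mathring{\phi}_1}(\xi)=1+\mathscr{O}(|\xi|^n)\quad\text{and}\quad\widehat{\mathring{\phi}_\ell}(\xi)=\mathscr{O}(|\xi|^n),\quad\xi\to0,\ \ell=2,\ldots,r,$$ and $\mathring{a}$ has $m$ sum rules with respect to $d$ with the matching filter $\mathring{\upsilon}$ satisfying $$\widehat{\mathring{\upsilon}_1}(\xi)=1+\mathscr{O}(|\xi|^m)\quad\text{and}\quad\widehat{\mathring{\upsilon}_\ell}(\xi)=\mathscr{O}(|\xi|^m),\quad\xi\to0,\ \ell=2,\ldots,r.$$ (ii) If in addition $$\widehat{\upsilon}(\xi)=\frac{\overline{\widehat{\phi}(\xi)}^{\mathsf T}}{\|\widehat{\phi}(\xi)\|^2}+\mathscr{O}(|\xi|^m),\quad\xi\to0,\qquad(\ast)$$ then $\widehat{U}$ in item (i) can be chosen such that $$\overline{\widehat{U}(\xi)}^{-\mathsf T}\widehat{U}(\xi)^{-1}=\operatorname{Diag}\left(\|\widehat{\phi}(\xi)\|^2,\|\widehat{u_2}(\xi)\|^2,\ldots,\|\widehat{u_r}(\xi)\|^2\right)+\mathscr{O}(|\xi|^{\max(m,n)}),\quad\xi\to0,\qquad(\ast\ast)$$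 where $\widehat{u_j}$ is the $j$-th column of $\widehat{U}^{-1}$ for $j=2,\ldots,r$. Conversely, if there exists a strongly invertible $r\times r$ matrix $\widehat{U}$ of $2\pi$-periodic trigonometric polynomials such that item (i) and $(\ast\ast)$ hold, then $(\ast)$ must hold.
   Context: $l_0(\mathbb{Z})$ is the set of finitely supported complex sequences on $\mathbb{Z}$; for $u\in(l_0(\mathbb{Z}))^{s\times r}$, $\widehat{u}(\xi):=\sum_{k}u(k)e^{-ik\xi}$, $\xi\in\mathbb{R}$. The Fourier transform is $\widehat{f}(\xi)=\int f(x)e^{-ix\xi}dx$, extended to tempered distributions and applied entrywise to vectors. For $m\in\mathbb{N}$ (positive integers), $f(\xi)=g(\xi)+\mathscr{O}(|\xi|^m)$ as $\xi\to0$ means $f^{(j)}(0)=g^{(j)}(0)$ for $j=0,\ldots,m-1$ (entrywise). $\|\cdot\|$ is the Euclidean norm on $\mathbb{C}^r$, and $\overline{M}^{-\mathsf T}$ denotes the inverse of the conjugate transpose $\overline{M}^{\mathsf T}$. An $r\times r$ matrix of $2\pi$-periodic trigonometric polynomials is strongly invertible if its inverse is also a matrix of $2\pi$-periodic trigonometric polynomials. For $m\in\mathbb{N}$, $a\in(l_0(\mathbb{Z}))^{r\times r}$ has $m$ sum rules with respect to $d$ with matching filter $\upsilon$ if $\widehat{\upsilon}(0)\ne0$ and, as $\xi\to0$, $\widehat{\upsilon}(d\xi)\widehat{a}(\xi)=\widehat{\upsilon}(\xi)+\mathscr{O}(|\xi|^m)$ and $\widehat{\upsilon}(d\xi)\widehat{a}(\xi+\frac{2\pi\gamma}{d})=\mathscr{O}(|\xi|^m)$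 for $\gamma=1,\ldots,d-1$.
   Formalization: The converse is stated only for n ≥ m, since for n < m it fails: d=m=r=2, n=1, U=I, υ̂=[1,0], â=[[z⁻¹((1+z)/2)²,0],[1−z,0]] with z=e^{−iξ} satisfies (i) and (∗∗) but not (∗). *)

(* Defs.v *)
From HB Require Import structures.
From mathcomp Require Import all_boot all_order all_algebra.
From mathcomp Require Import spectral finmap complex.
From mathcomp Require Import boolp classical_sets reals ereal topology.
From mathcomp Require Import normedtype sequences derive trigo.

Set Implicit Arguments.
Unset Strict Implicit.
Unset Printing Implicit Defensive.

Import Order.TTheory GRing.Theory Num.Theory.
Import numFieldNormedType.Exports.

Local Open Scope classical_set_scope.
Local Open Scope ring_scope.
Local Open Scope complex_scope.
Local Open Scope sesquilinear_scope.

(* The library has no normed R-module structure on R[i], so derivatives are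
   taken on real and imaginary parts. *)
Definition cderiv (R : realType) (k : nat) (f : R -> R[i]) : R -> R[i] :=
  fun x => (derive1n k (fun t => complex.Re (f t)) x)
           +i* (derive1n k (fun t => complex.Im (f t)) x).

Definition smooth (R : realType) (f : R -> R[i]) : Prop :=
  forall (k : nat) (x : R),
    derivable (derive1n k (fun t => complex.Re (f t))) x 1 /\
    derivable (derive1n k (fun t => complex.Im (f t))) x 1.

(* [eqO m f g] is f(xi) = g(xi) + O(|xi|^m) as xi -> 0, meaning entrywise
   equality of the derivatives of order < m at 0. *)
Definition eqO (R : realType) (p q : nat) (m : nat)
    (f g : R -> 'M[R[i]]_(p, q)) : Prop :=
  forall (k : nat), (k < m)%N -> forall (i : 'I_p) (j : 'I_q),
    cderiv k (fun xi => f xi i j) 0 = cderiv k (fun xi => g xi i j) 0.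

(* e^{it} *)
Definition expi (R : realType) (t : R) : R[i] := (cos t) +i* (sin t).

Definition euclid_norm (R : realType) (r : nat) (v : 'cV[R[i]]_r) : R[i] :=
  sqrtC (\sum_(i < r) `|v i ord0| ^+ 2).

Definition l0 (R : realType) (p q : nat) :=
  {fsfun int -> 'M[R[i]]_(p, q) with 0}.

(* The functions of the form [fourier u] are exactly the p x q matrices of
   2pi-periodic trigonometric polynomials, and [fourier u] determines u. *)
Definition fourier (R : realType) (p q : nat) (u : l0 R p q) (xi : R) :
    'M[R[i]]_(p, q) :=
  \sum_(k <- finsupp u) expi (- (k%:~R * xi)) *: u k.

Definition strongly_invertible (R : realType) (r : nat) (U : l0 R r r) : Prop :=
  (forall xi, fourier U xi \in unitmx) /\
  exists V : l0 R r r, forall xi, invmx (fourier U xi) = fourier V xi.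

Definition sum_rules (R : realType) (r d m : nat) (a : l0 R r r)
    (v : l0 R 1 r) : Prop :=
  [/\ fourier v 0 != 0,
      eqO m (fun xi => fourier v (d%:R * xi) *m fourier a xi) (fourier v)
    & forall g : nat, (1 <= g <= d.-1)%N ->
        eqO m (fun xi => fourier v (d%:R * xi)
                         *m fourier a (xi + 2 * pi * g%:R / d%:R))
              (fun _ => 0)].

(* E'(R), the continuous linear functionals on C^infty(R) (values on
   non-smooth functions are irrelevant).  The last field is continuity,
     |T f| <= K * max_{k <= N} sup_{|x| <= A} |f^(k)(x)|,
   with the supremum written through its upper bounds B; it forces
   supp T to lie in [-A, A]. *)
Record csdist (R : realType) := CSDist {
  csd_fun :> (R -> R[i]) -> R[i];
  csd_linear : forall (c : R[i]) (f g : R -> R[i]), smooth f -> smooth g ->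
    csd_fun (fun x => c * f x + g x) = c * csd_fun f + csd_fun g;
  csd_cont : exists (A K : R) (N : nat),
    forall (f : R -> R[i]) (B : R), smooth f ->
      (forall (k : nat) (x : R), (k <= N)%N -> `|x| <= A ->
         `|cderiv k f x| <= B%:C) ->
      `|csd_fun f| <= (K * B)%:C
}.

(* The Fourier transform of a compactly supported distribution is the function
   xi |-> <T, e^{-i x xi}>, i.e. the pairing that extends
   \int f(x) e^{-i x xi} dx. *)
Definition csd_fourier (R : realType) (T : csdist R) (xi : R) : R[i] :=
  T (fun x => expi (- (x * xi))).

Definition csd_fourier_vec (R : realType) (r : nat) (phi : 'I_r -> csdist R)
    (xi : R) : 'cV[R[i]]_r :=
  \col_i csd_fourier (phi i) xi.

(* The multiplicity is written 1 + s so that the block decomposition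
   1 + (r - 1) is available in the types.  [phihat] is the Fourier transform of
   the refinable vector; [a'], [v'] are the transformed filters (ring a) and
   (ring upsilon), whose Fourier series are prescribed.  The vector
   [fourier U xi *m phihat xi] is the Fourier transform of (ring phi). *)
Definition normal_form (R : realType) (s d m n : nat)
    (a : l0 R (1 + s) (1 + s)) (v : l0 R 1 (1 + s))
    (phihat : R -> 'cV[R[i]]_(1 + s)) (U : l0 R (1 + s) (1 + s)) : Prop :=
  exists (a' : l0 R (1 + s) (1 + s)) (v' : l0 R 1 (1 + s)),
  let phihat' := fun xi => fourier U xi *m phihat xi in
  [/\ forall xi, fourier a' xi =
        fourier U (d%:R * xi) *m fourier a xi *m invmx (fourier U xi),
      exists (P11 : l0 R 1 1) (P12 : l0 R 1 s) (P21 : l0 R s 1)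
             (P22 : l0 R s s),
        let a11 := fun xi =>
          (\sum_(k < d) expi (- (k%:R * xi))) ^+ m *: fourier P11 xi in
        (forall xi, fourier a' xi =
           block_mx (a11 xi)
                    ((1 - expi (- (d%:R * xi))) ^+ m *: fourier P12 xi)
                    ((1 - expi (- xi)) ^+ n *: fourier P21 xi)
                    (fourier P22 xi)) /\
        eqO n a11 (fun _ => 1%:M),
      forall xi, fourier v' xi = fourier v xi *m invmx (fourier U xi),
      (forall xi, phihat' (d%:R * xi) = fourier a' xi *m phihat' xi) /\
      eqO n phihat' (fun _ => col_mx 1%:M 0)
    & sum_rules d m a' v' /\ eqO m (fourier v') (fun _ => row_mx 1%:M 0)].

Definition matching_dual (R : realType) (r m : nat) (v : l0 R 1 r)
    (phihat : R -> 'cV[R[i]]_r) : Prop :=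
  eqO m (fourier v)
        (fun xi => (euclid_norm (phihat xi) ^+ 2)^-1 *: (phihat xi) ^t*).

Definition almost_orthogonal (R : realType) (s m n : nat)
    (phihat : R -> 'cV[R[i]]_(1 + s)) (U : l0 R (1 + s) (1 + s)) : Prop :=
  eqO (maxn m n)
      (fun xi => invmx ((fourier U xi) ^t*) *m invmx (fourier U xi))
      (fun xi => diag_mx (\row_(j < 1 + s)
         if j == ord0 then euclid_norm (phihat xi) ^+ 2
         else euclid_norm (col j (invmx (fourier U xi))) ^+ 2)).

(* Main.v *)
Require Import Defs.
From HB Require Import structures.
From mathcomp Require Import all_boot all_order all_algebra.
From mathcomp Require Import spectral finmap complex.
From mathcomp Require Import boolp classical_sets reals ereal topology.
From mathcomp Require Import normedtype sequences derive trigo realfun.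
From mathcomp Require Import ring lra.
Import Order.TTheory GRing.Theory Num.Theory.
Import numFieldNormedType.Exports.

Set Implicit Arguments.
Unset Strict Implicit.
Unset Printing Implicit Defensive.

Local Open Scope classical_set_scope.
Local Open Scope ring_scope.
Local Open Scope complex_scope.
Local Open Scope sesquilinear_scope.

(** Write z = e^{-i xi}. The conditions on phi, v and U concern jets at xi = 0
    of smooth functions, and every jet is the jet of a polynomial in z
    ([zeval_approx]); so one can argue over the local ring of jets, as long as
    only elementary matrices are used: replacing their entries by polynomials
    with the same jets keeps them invertible over {poly C}. The Fourier
    transform of the refinable vector has jets because the pairing of a
    compactly supported distribution with e^{-i x xi} may be differentiated in
    xi ([is_cderive_moment]).

    The refinement equation and the sum rule at 0 make v phi invariant under
    xi |-> d xi up to O(|xi|^m), so v phi = 1 + O(|xi|^m)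
    ([compatible_pairing]). Since r >= 2, elementary operations bring phi to
    e_1 to any prescribed order, and one more shear brings v to e_1^T to order m
    ([reduce_to_e1], [exists_normalization]). For such a U the sum rules and
    the refinement equation become statements about zeros of the first row and
    column of the new mask, and zeros of order m at points of the circle can be
    divided out of Laurent polynomials ([trig_vanish],
    [normal_form_of_normalization]). This is part (i).

    For part (ii) the columns of the inverse of a matrix that normalizes phi
    are made orthogonal by Gram-Schmidt. The jets of the first column, which are
    those of phi, are kept, and the matrices used are again polynomial and
    invertible ([gram_schmidt]). The condition on v then says that v
    is dual to the first column, so v is normalized as well
    ([exists_orthogonal_normalization]). The converse is the same computation
    read backwards ([dual_of_orthogonal]). *)

(** * Differentiation of complex functions of a real variable *)

Section ComplexDerivative.
Variable R : realType.
Notation C := R[i].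
Notation Re := (@complex.Re R).
Notation Im := (@complex.Im R).
Implicit Types (f g : R -> C) (x y : R) (z w l : C) (U : set R).

Lemma Re_add z w : Re (z + w) = Re z + Re w. Proof. by case: z w => [a b] []. Qed.
Lemma Im_add z w : Im (z + w) = Im z + Im w. Proof. by case: z w => [a b] []. Qed.
Lemma Re_mul z w : Re (z * w) = Re z * Re w - Im z * Im w.
Proof. by case: z w => [a b] []. Qed.
Lemma Im_mul z w : Im (z * w) = Re z * Im w + Im z * Re w.
Proof. by case: z w => [a b] []. Qed.

Lemma Re_opp z : Re (- z) = - Re z. Proof. by case: z. Qed.
Lemma Im_opp z : Im (- z) = - Im z. Proof. by case: z. Qed.

Lemma complex_ext z w : Re z = Re w -> Im z = Im w -> z = w.
Proof. by case: z w => [a b] [c d] /= -> ->. Qed.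

(** The complex derivative is taken on real and imaginary parts, as in cderiv.
    *)
Definition is_cderive f x l :=
  is_derive x 1 (fun t => Re (f t)) (Re l) /\
  is_derive x 1 (fun t => Im (f t)) (Im l).

Lemma cderiv1_val f x l : is_cderive f x l -> cderiv 1 f x = l.
Proof.
case=> [[? h1] [? h2]]; apply: complex_ext; rewrite /cderiv /= derive1E //.
Qed.

Lemma is_cderive_continuous f x l : is_cderive f x l ->
  {for x, continuous (fun t => Re (f t))} /\
  {for x, continuous (fun t => Im (f t))}.
Proof.
by case=> [[h1 _] [h2 _]]; split; apply/differentiable_continuous/derivable1_diffP.
Qed.

Lemma is_cderive_eq f x l l' : l = l' -> is_cderive f x l -> is_cderive f x l'.
Proof. by move->. Qed.

Lemma is_cderive_ext U f g x l : open U -> U x -> {in U, f =1 g} ->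
  is_cderive f x l -> is_cderive g x l.
Proof.
move=> oU Ux fg [h1 h2].
have nU : \forall t \near x, U t by apply: open_nbhs_nbhs.
split; [apply: near_eq_is_derive h1 | apply: near_eq_is_derive h2];
  by near=> t; rewrite fg // inE; near: t.
Unshelve. all: by end_near. Qed.

Lemma is_cderive_const z x : is_cderive (fun _ => z) x 0.
Proof. by split; apply: is_derive_cst. Qed.

(** Differentiation rules for functions of the form fun t => u t + v t, which
    is how the real and imaginary parts of complex products present
    themselves. *)
Lemma is_derive_add (u v : R -> R) x a b : is_derive x 1 u a -> is_derive x 1 v b ->
  is_derive x 1 (fun t => u t + v t) (a + b).
Proof. by move=> hu hv; exact: (@is_deriveD _ _ _ u v). Qed.

Lemma is_derive_opp (u : R -> R) x a : is_derive x 1 u a ->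
  is_derive x 1 (fun t => - u t) (- a).
Proof. by move=> hu; exact: (@is_deriveN _ _ _ u). Qed.

Lemma is_derive_mul (u v : R -> R) x a b : is_derive x 1 u a -> is_derive x 1 v b ->
  is_derive x 1 (fun t => u t * v t) (u x * b + v x * a).
Proof. by move=> hu hv; exact: (@is_deriveM _ _ u v). Qed.

Lemma is_derive_inv (u : R -> R) x a : u x != 0 -> is_derive x 1 u a ->
  is_derive x 1 (fun t => (u t)^-1) (- (u x) ^- 2 * a).
Proof.
move=> ux hu; have du : derivable u x 1 by case: hu.
by apply: DeriveDef; [exact: derivableV | rewrite deriveV // derive_val].
Qed.

Lemma is_cderiveD f g x k l : is_cderive f x k -> is_cderive g x l ->
  is_cderive (fun t => f t + g t) x (k + l).
Proof.
move=> [f1 f2] [g1 g2]; split.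
  rewrite Re_add (_ : (fun t => _) = fun t => Re (f t) + Re (g t)).
    exact: is_derive_add.
  by apply/funext => t /=; rewrite Re_add.
rewrite Im_add (_ : (fun t => _) = fun t => Im (f t) + Im (g t)).
  exact: is_derive_add.
by apply/funext => t /=; rewrite Im_add.
Qed.

Lemma is_cderiveM f g x k l : is_cderive f x k -> is_cderive g x l ->
  is_cderive (fun t => f t * g t) x (k * g x + f x * l).
Proof.
move=> [f1 f2] [g1 g2]; split.
  rewrite (_ : (fun t => _) = fun t => Re (f t) * Re (g t) + - (Im (f t) * Im (g t))).
    apply: (is_derive_eq (is_derive_add (is_derive_mul f1 g1)
        (is_derive_opp (is_derive_mul f2 g2)))).
    by rewrite Re_add !Re_mul; ring.
  by apply/funext => t /=; rewrite Re_mul.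
rewrite (_ : (fun t => _) = fun t => Re (f t) * Im (g t) + Im (f t) * Re (g t)).
  apply: (is_derive_eq (is_derive_add (is_derive_mul f1 g2) (is_derive_mul f2 g1))).
  by rewrite Im_add !Im_mul; ring.
by apply/funext => t /=; rewrite Im_mul.
Qed.

Lemma is_cderive_conj f x l : is_cderive f x l ->
    is_cderive (fun t => (f t)^*%C) x (l^*%C).
Proof.
move=> [f1 f2]; split.
  rewrite (_ : (fun t => _) = fun t => Re (f t)); first by case: l f1 f2.
  by apply/funext => t /=; case: (f t).
rewrite (_ : (fun t => _) = fun t => - Im (f t)).
  by case: l f1 f2 => a b f1 f2 /=; apply: is_derive_opp.
by apply/funext => t /=; case: (f t).
Qed.

(** The real and imaginary parts of 1 / f are Re f / |f|^2 and - Im f / |f|^2,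
    so the real quotient rule applies; what remains is a rational identity. *)
Lemma is_cderiveV f x l : f x != 0 -> is_cderive f x l ->
  is_cderive (fun t => (f t)^-1) x (- l * (f x)^-1 * (f x)^-1).
Proof.
move=> fx0 [f1 f2].
pose q t := Re (f t) * Re (f t) + Im (f t) * Im (f t).
have qx0 : q x != 0.
  rewrite /q; apply: contra fx0; rewrite -!expr2.
  rewrite paddr_eq0 ?sqr_ge0 // !sqrf_eq0 => /andP[/eqP h1 /eqP h2].
  by apply/eqP; apply: complex_ext.
have dq := is_derive_inv qx0
    (is_derive_add (is_derive_mul f1 f1) (is_derive_mul f2 f2)).
have ReV z : Re z^-1 = Re z * (Re z * Re z + Im z * Im z)^-1.
  by rewrite -!expr2; case: z.
have ImV z : Im z^-1 = - Im z * (Re z * Re z + Im z * Im z)^-1.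
  by rewrite -!expr2; case: z => a b /=; rewrite mulNr.
move: qx0; rewrite /q => qx0; split.
  rewrite (_ : (fun t => _) = fun t => Re (f t) * (q t)^-1).
    apply: (is_derive_eq (is_derive_mul f1 dq)).
    rewrite !(Im_mul, Re_mul) ReV ImV !Re_opp !Im_opp /q.
    by move: (Re _) (Im _) (Re _) (Im _) qx0 => a b c e h; field.
  by apply/funext => t /=; rewrite ReV.
rewrite (_ : (fun t => _) = fun t => - Im (f t) * (q t)^-1).
  apply: (is_derive_eq (is_derive_mul (is_derive_opp f2) dq)).
  rewrite !(Im_mul, Re_mul) ReV ImV !Re_opp !Im_opp /q.
  by move: (Re _) (Im _) (Re _) (Im _) qx0 => a b c e h; field.
by apply/funext => t /=; rewrite ImV.
Qed.

Lemma is_cderive_comp_affine f (c e : R) x l : is_cderive f (c * x + e) l ->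
  is_cderive (fun t => f (c * t + e)) x (c%:C * l).
Proof.
move=> [f1 f2].
have aff (h : R -> R) k : is_derive (c * x + e) 1 h k ->
    is_derive x 1 (fun t => h (c * t + e)) (c * k).
  move=> hk.
  have da : is_derive x 1 (fun t : R => c * t + e) c.
    apply: (is_derive_eq (is_derive_add
        (is_derive_mul (is_derive_cst c x 1) (is_derive_id x 1))
      (is_derive_cst e x 1))).
    by rewrite addr0 mulr0 addr0 mulr1.
  by rewrite mulrC; exact: (@is_derive1_comp _ h _ x _ _ hk da).
split; first by rewrite Re_mul /= mul0r subr0; exact: (aff (Re \o f)).
by rewrite Im_mul /= mul0r addr0; exact: (aff (Im \o f)).
Qed.

Lemma is_cderive_expi x : is_cderive (@expi R) x ('i%C * expi x).
Proof.
split; rewrite /expi ?Re_mul ?Im_mul /=.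
  by rewrite mul0r sub0r mul1r; apply: is_derive_cos.
by rewrite mul0r add0r mul1r; apply: is_derive_sin.
Qed.

End ComplexDerivative.

(** * Smoothness near the origin and jets *)

Section Smoothness.
Variable R : realType.
Notation C := R[i].
Implicit Types (f g : R -> C) (x y : R) (z w l : C) (U V : set R).

Definition cder f : R -> C := cderiv 1 f.

(** n-fold differentiability on U. The recursion goes through the derivative
    of f, so that closure under products, inverses and so on follows by
    induction on n from the rule for one derivative, without the Leibniz
    formula for higher derivatives. *)
Fixpoint Cn_on U n f : Prop :=
  if n is m.+1 then (forall x, U x -> is_cderive f x (cder f x)) /\ Cn_on U m (cder f)
  else True.

Lemma cderivS k f : cderiv k.+1 f = cderiv k (cder f).
Proof.
by apply/funext => x; rewrite /cderiv /cder /cderiv !derive1Sn.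
Qed.

Lemma cderiv0 f : cderiv 0 f = f.
Proof. by apply/funext => x; rewrite /cderiv /=; case: (f x). Qed.

Lemma cder_ext U f g : open U -> {in U, f =1 g} -> {in U, cder f =1 cder g}.
Proof.
move=> oU fg x; rewrite inE => Ux; apply: complex_ext;
    rewrite /cder /cderiv /= !derive1E;
  apply: near_eq_derive; have nU : \forall t \near x, U t by [apply: open_nbhs_nbhs];
  by near=> t; rewrite fg // inE; near: t.
Unshelve. all: by end_near. Qed.

Lemma cderiv_ext U f g k : open U -> {in U, f =1 g} ->
    {in U, cderiv k f =1 cderiv k g}.
Proof.
move=> oU; elim: k f g => [|k IH] f g fg; first by rewrite !cderiv0.
by rewrite !cderivS; apply/IH/cder_ext.
Qed.

Lemma Cn_on_ext U n f g : open U -> {in U, f =1 g} -> Cn_on U n f -> Cn_on U n g.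
Proof.
move=> oU; elim: n f g => [//|n IH] f g fg /= [df sf]; split; last first.
  exact: IH (cder_ext oU fg) sf.
move=> x Ux; rewrite -(cder_ext oU fg) ?inE //.
exact: is_cderive_ext oU Ux fg (df x Ux).
Qed.

(** A function is in C^(n+1) as soon as some candidate derivative, given by a
    formula, is in C^n; this is how all the closure properties are obtained.
    *)
Lemma Cn_on_step U n f f' : open U -> (forall x, U x -> is_cderive f x (f' x)) ->
  Cn_on U n f' -> Cn_on U n.+1 f.
Proof.
move=> oU df sf; have e : {in U, f' =1 cder f}.
  by move=> x; rewrite inE => Ux; rewrite /cder (cderiv1_val (df x Ux)).
split; last exact: Cn_on_ext e sf.
by move=> x Ux; rewrite -e ?inE //; apply: df.
Qed.

Lemma Cn_on_pred U n f : Cn_on U n.+1 f -> Cn_on U n f.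
Proof. by elim: n f => [//|n IH] f [df /IH sf]. Qed.

Lemma Cn_on_sub U V n f : V `<=` U -> Cn_on U n f -> Cn_on V n f.
Proof.
move=> VU; elim: n f => [//|n IH] f [df /IH sf]; split => // x /VU; exact: df.
Qed.

Lemma Cn_on_const U n z : open U -> Cn_on U n (fun _ => z).
Proof.
move=> oU; elim: n z => [//|n IH] z; apply: Cn_on_step (IH 0) => // x _.
exact: is_cderive_const.
Qed.

Lemma Cn_onD U n f g : open U -> Cn_on U n f -> Cn_on U n g ->
  Cn_on U n (fun t => f t + g t).
Proof.
move=> oU; elim: n f g => [//|n IH] f g [df sf] [dg sg].
by apply: Cn_on_step (IH _ _ sf sg) => // x Ux; apply: is_cderiveD; auto.
Qed.

Lemma Cn_onM U n f g : open U -> Cn_on U n f -> Cn_on U n g ->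
  Cn_on U n (fun t => f t * g t).
Proof.
move=> oU; elim: n f g => [//|n IH] f g sf sg.
have [df sf'] := sf; have [dg sg'] := sg.
apply: (@Cn_on_step _ _ _ (fun x => cder f x * g x + f x * cder g x)) => //.
  by move=> x Ux; apply: is_cderiveM; auto.
by apply: Cn_onD => //; apply: IH => //; apply: Cn_on_pred.
Qed.

Lemma Cn_on_conj U n f : open U -> Cn_on U n f -> Cn_on U n (fun t => (f t)^*%C).
Proof.
move=> oU; elim: n f => [//|n IH] f [df /IH sf].
by apply: Cn_on_step sf => // x Ux; apply: is_cderive_conj; auto.
Qed.

Lemma Cn_onV U n f : open U -> (forall x, U x -> f x != 0) -> Cn_on U n f ->
  Cn_on U n (fun t => (f t)^-1).
Proof.
move=> oU f0; elim: n => [//|n IH] sf; have [df sf'] := sf.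
apply: (@Cn_on_step _ _ _ (fun x => - 1 * cder f x * (f x)^-1 * (f x)^-1)) => //.
  by move=> x Ux; rewrite mulN1r; apply: is_cderiveV; auto.
by do ![apply: Cn_onM => //]; [apply: Cn_on_const | apply: IH; apply: Cn_on_pred
  | apply: IH; apply: Cn_on_pred].
Qed.

Lemma Cn_on_affine U n f (c e : R) : open U -> Cn_on U n f ->
  Cn_on [set t | U (c * t + e)] n (fun t => f (c * t + e)).
Proof.
move=> oU; have oV : open [set t | U (c * t + e)].
  apply: (@open_comp _ _ (fun t : R => c * t + e)) => // t _.
  apply: continuousD; last exact: cst_continuous.
  by apply: continuousM; [exact: cst_continuous | exact: cvg_id].
elim: n f => [//|n IH] f [df /IH sf].
apply: (@Cn_on_step _ _ _ (fun t => c%:C * cder f (c * t + e))) => //.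
  by move=> x Ux; apply: is_cderive_comp_affine; auto.
by apply: Cn_onM => //; apply: Cn_on_const.
Qed.

Lemma Cn_on_expi n : Cn_on setT n (@expi R).
Proof.
elim: n => [//|n IH]; apply: (@Cn_on_step _ _ _ (fun t => 'i%C * expi t)) => //.
- exact: openT.
- by move=> x _; apply: is_cderive_expi.
- by apply: Cn_onM => //; [exact: openT | apply: Cn_on_const; exact: openT].
Qed.

Lemma Cn_on_expi_affine n (c e : R) : Cn_on setT n (fun t => expi (c * t + e)).
Proof. exact: (Cn_on_affine c e openT (Cn_on_expi n)). Qed.

Lemma Cn_on_id n : Cn_on setT n (fun t : R => t%:C).
Proof.
case: n => [//|n]; apply: (@Cn_on_step _ _ _ (fun=> 1)); [exact: openT | |].
  by move=> x _; split => /=; [apply: is_derive_id | apply: is_derive_cst].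
by apply: Cn_on_const; exact: openT.
Qed.

Lemma Cn_on_smooth f : (forall n, Cn_on setT n f) -> smooth f.
Proof.
move=> sf k x; have := sf k.+1; elim: k f {sf} => [|k IH] f.
  by case=> df _; have [h1 h2] := df x I; rewrite !derive1n0; split; apply: ex_derive.
case=> _ /IH; rewrite !derive1Sn.
have -> : (fun t => complex.Re (cder f t)) = derive1 (fun t => complex.Re (f t)).
  exact: erefl.
have -> : (fun t => complex.Im (cder f t)) = derive1 (fun t => complex.Im (f t)).
  exact: erefl.
exact.
Qed.

(** Smoothness is required only near 0, because 1 / |phi|^2 is smooth only
    where phi does not vanish. The neighbourhood is the same for all orders.
    *)
Definition smooth0 f := exists U, [/\ open U, U 0 & forall n, Cn_on U n f].

Lemma smooth0T f : (forall n, Cn_on setT n f) -> smooth0 f.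
Proof. by exists setT; split => //; exact: openT. Qed.

Lemma smooth0_const z : smooth0 (fun _ => z).
Proof. by apply: smooth0T => n; apply: Cn_on_const; exact: openT. Qed.

Lemma smooth0_binary (P : (R -> C) -> (R -> C) -> R -> C) f g :
  (forall U n, open U -> Cn_on U n f -> Cn_on U n g -> Cn_on U n (P f g)) ->
  smooth0 f -> smooth0 g -> smooth0 (P f g).
Proof.
move=> H [U [oU U0 sf]] [V [oV V0 sg]]; exists (U `&` V); split => //.
  exact: openI.
move=> n; apply: H; [exact: openI | apply: Cn_on_sub (sf n) | apply: Cn_on_sub
    (sg n)].
  by move=> x [].
by move=> x [].
Qed.

Lemma smooth0D f g : smooth0 f -> smooth0 g -> smooth0 (fun t => f t + g t).
Proof.
by apply: (@smooth0_binary (fun f g t => f t + g t)) => U n; apply: Cn_onD.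
Qed.

Lemma smooth0M f g : smooth0 f -> smooth0 g -> smooth0 (fun t => f t * g t).
Proof.
by apply: (@smooth0_binary (fun f g t => f t * g t)) => U n; apply: Cn_onM.
Qed.

Lemma smooth0N f : smooth0 f -> smooth0 (fun t => - f t).
Proof.
move=> sf; rewrite (_ : (fun t => _) = fun t => -1 * f t).
  by apply: smooth0M => //; apply: smooth0_const.
by apply/funext => t; rewrite mulN1r.
Qed.

Lemma smooth0B f g : smooth0 f -> smooth0 g -> smooth0 (fun t => f t - g t).
Proof. by move=> sf /smooth0N sg; apply: smooth0D. Qed.

Lemma smooth0_sum (I : Type) (s : seq I) (P : pred I) (F : I -> R -> C) :
  (forall i, smooth0 (F i)) -> smooth0 (fun t => \sum_(i <- s | P i) F i t).
Proof.
move=> sF; elim: s => [|i s IH].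
  rewrite (_ : (fun t => _) = fun=> 0); first exact: smooth0_const.
  by apply/funext => t; rewrite big_nil.
rewrite (_ : (fun t => _) = fun t => (if P i then F i t else 0)
    + \sum_(i <- s | P i) F i t).
  by apply: smooth0D => //; case: (P i) => //; apply: smooth0_const.
by apply/funext => t; rewrite big_cons; case: (P i); rewrite ?add0r.
Qed.

Lemma smooth0_conj f : smooth0 f -> smooth0 (fun t => (f t)^*%C).
Proof. by case=> U [oU U0 sf]; exists U; split => // n; apply: Cn_on_conj. Qed.

Lemma smooth0_affine f c : smooth0 f -> smooth0 (fun t => f (c * t)).
Proof.
case=> U [oU U0 sf]; exists [set t | U (c * t + 0)]; split.
- apply: (@open_comp _ _ (fun t : R => c * t + 0)) => // t _.
  apply: continuousD; last exact: cst_continuous.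
  by apply: continuousM; [exact: cst_continuous | exact: cvg_id].
- by rewrite /= mulr0 addr0.
- move=> n; have := Cn_on_affine c 0 oU (sf n).
  by rewrite (_ : (fun t => _) = fun t => f (c * t)) //; apply/funext => t;
      rewrite addr0.
Qed.

(** Continuity of |f|^2 gives a neighbourhood of 0 on which f does not vanish.
    *)
Lemma smooth0_nonzero f : smooth0 f -> f 0 != 0 ->
  exists U, [/\ open U, U 0, forall x, U x -> f x != 0 & forall n, Cn_on U n f].
Proof.
case=> U [oU U0 sf] f0; pose q t := complex.Re (f t * (f t)^*%C).
have qE t : (q t == 0) = (f t == 0).
  rewrite /q; case: (f t) => a b /=; rewrite mulrN opprK -!expr2.
  by rewrite paddr_eq0 ?sqr_ge0 // !sqrf_eq0 eq_complex.
have qc t : U t -> {for t, continuous q}.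
  move=> Ut; have sq := Cn_onM oU (sf 1%N) (Cn_on_conj oU (sf 1%N)).
  by case: sq => /(_ t Ut)/is_cderive_continuous[].
exists (U `&` (q @^-1` [set y | y != 0])); split => //.
- rewrite openE => t [Ut qt]; apply: filterI; first exact: open_nbhs_nbhs.
  by apply: (qc t Ut); apply: open_nbhs_nbhs; split => //; exact: open_neq.
- by split => //=; rewrite qE.
- by move=> x [_] /=; rewrite qE.
- by move=> n; apply: Cn_on_sub (sf n) => x [].
Qed.

Lemma smooth0V f : smooth0 f -> f 0 != 0 -> smooth0 (fun t => (f t)^-1).
Proof.
move=> sf /(smooth0_nonzero sf) [U [oU U0 Uf sU]].
by exists U; split => // n; apply: Cn_onV.
Qed.

Lemma smooth0_cder f : smooth0 f -> smooth0 (cder f).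
Proof. by case=> U [oU U0 sf]; exists U; split => // n; case: (sf n.+1). Qed.

Lemma smooth0_expi (c e : R) : smooth0 (fun t => expi (c * t + e)).
Proof. by apply: smooth0T => n; apply: Cn_on_expi_affine. Qed.

(** Scalar form of eqO: equality of the jets of order n at 0. *)
Definition eqjet n f g := forall k, (k < n)%N -> cderiv k f 0 = cderiv k g 0.

(** The recursion on which all congruence properties of jets rest. *)
Lemma eqjetS n f g : eqjet n.+1 f g <-> f 0 = g 0 /\ eqjet n (cder f) (cder g).
Proof.
split=> [h|[h0 h] [|k] kn]; last 2 first.
- by rewrite !cderiv0.
- by rewrite !cderivS; apply: h.
split; first by have := h 0%N erefl; rewrite !cderiv0.
by move=> k kn; rewrite -!cderivS; apply: h.
Qed.

Lemma eqjet_refl n f : eqjet n f f. Proof. by []. Qed.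
Lemma eqjet_sym n f g : eqjet n f g -> eqjet n g f.
Proof. by move=> h k /h. Qed.
Lemma eqjet_trans n g f h : eqjet n f g -> eqjet n g h -> eqjet n f h.
Proof. by move=> h1 h2 k kn; rewrite h1 // h2. Qed.
Lemma eqjet_le m n f g : (m <= n)%N -> eqjet n f g -> eqjet m f g.
Proof. by move=> mn h k km; apply: h; apply: leq_trans mn. Qed.
Lemma eqjet_ext U n f g : open U -> U 0 -> {in U, f =1 g} -> eqjet n f g.
Proof. by move=> oU U0 fg k _; apply: (cderiv_ext _ oU fg); rewrite inE. Qed.

Lemma eqjet_on U n f g f' g' : open U -> U 0 -> {in U, f =1 f'} -> {in U, g =1 g'} ->
  eqjet n f' g' -> eqjet n f g.
Proof.
move=> oU U0 ff gg h; apply: (@eqjet_trans _ f'); first exact: eqjet_ext oU U0 ff.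
by apply: (@eqjet_trans _ g') => //; apply/eqjet_sym/(eqjet_ext oU U0 gg).
Qed.

Lemma cderD f g U : open U -> Cn_on U 1 f -> Cn_on U 1 g ->
  {in U, cder (fun t => f t + g t) =1 fun t => cder f t + cder g t}.
Proof.
move=> oU [df _] [dg _] x; rewrite inE => Ux; rewrite {1}/cder.
by apply: cderiv1_val; apply: is_cderiveD; auto.
Qed.

Lemma cderM f g U : open U -> Cn_on U 1 f -> Cn_on U 1 g ->
  {in U, cder (fun t => f t * g t) =1 fun t => cder f t * g t + f t * cder g t}.
Proof.
move=> oU [df _] [dg _] x; rewrite inE => Ux; rewrite {1}/cder.
by apply: cderiv1_val; apply: is_cderiveM; auto.
Qed.

(** Two functions that are smooth near 0 may have different neighbourhoods;
    differentiation rules need a common one. *)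
Lemma smooth0_common (s : seq (R -> C)) : (forall f, List.In f s -> smooth0 f) ->
  exists U, [/\ open U, U 0 & forall f n, List.In f s -> Cn_on U n f].
Proof.
elim: s => [|f s IH] h; first by exists setT; split => //; exact: openT.
have [U [oU U0 sU]] := IH (fun g gs => h g (or_intror gs)).
have [V [oV V0 sV]] := h f (or_introl erefl).
exists (U `&` V); split => //; first exact: openI.
move=> g n [<-|gs]; first by apply: Cn_on_sub (sV n) => x [].
by apply: Cn_on_sub (sU g n gs) => x [].
Qed.

Lemma cderivD k f g : smooth0 f -> smooth0 g ->
  cderiv k (fun t => f t + g t) 0 = cderiv k f 0 + cderiv k g 0.
Proof.
elim: k f g => [|k IH] f g sf sg; first by rewrite !cderiv0.
have [] := @smooth0_common [:: f; g]; first by move=> h; do 2![case=> [<-//|]].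
move=> U [oU U0 sU]; rewrite !cderivS -IH; do ?exact: smooth0_cder.
apply: (@cderiv_ext U) => //; last by rewrite inE.
by apply: cderD => //; apply: sU => /=; tauto.
Qed.

Lemma eqjetD n f f' g g' : smooth0 f -> smooth0 f' -> smooth0 g -> smooth0 g' ->
  eqjet n f f' -> eqjet n g g' -> eqjet n (fun t => f t + g t) (fun t => f' t + g' t).
Proof. by move=> sf sf' sg sg' ff gg k kn; rewrite !cderivD // ff // gg. Qed.

(** Jets of order n at 0 multiply, because (f g)' = f' g + f g' expresses the
    jet of order n+1 of a product through products of jets of order n. *)
Lemma eqjetM n f f' g g' : smooth0 f -> smooth0 f' -> smooth0 g -> smooth0 g' ->
  eqjet n f f' -> eqjet n g g' -> eqjet n (fun t => f t * g t) (fun t => f' t * g' t).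
Proof.
elim: n f f' g g' => [//|n IH] f f' g g' sf sf' sg sg' ff gg.
have /eqjetS [f0 ff'] := ff; have /eqjetS [g0 gg'] := gg.
apply/eqjetS; split; first by rewrite f0 g0.
have [] := @smooth0_common [:: f; f'; g; g'].
  by move=> h; do 4![case=> [<-//|]].
move=> U [oU U0 sU]; apply: (eqjet_on oU U0).
- by apply: cderM => //; apply: sU => /=; tauto.
- by apply: cderM => //; apply: sU => /=; tauto.
- apply: eqjetD; do ?[apply: smooth0M => //; try exact: smooth0_cder].
    by apply: IH => //; [exact: smooth0_cder | exact: smooth0_cder | exact: eqjet_le gg].
  by apply: IH => //; [exact: smooth0_cder | exact: smooth0_cder | exact: eqjet_le ff].
Qed.

Lemma eqjet_conj n f g : smooth0 f -> smooth0 g -> eqjet n f g ->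
  eqjet n (fun t => (f t)^*%C) (fun t => (g t)^*%C).
Proof.
elim: n f g => [//|n IH] f g sf sg /eqjetS [fg0 fg].
apply/eqjetS; split; first by rewrite fg0.
have [] := @smooth0_common [:: f; g]; first by move=> h; do 2![case=> [<-//|]].
move=> U [oU U0 sU]; apply: (eqjet_on oU U0); last first.
- by apply: (IH (cder f) (cder g)) => //; apply: smooth0_cder.
- move=> x; rewrite inE => Ux; apply: cderiv1_val; apply: is_cderive_conj.
  have gs : List.In g [:: f; g] by right; left.
  by case: (sU g 1%N gs) => + _; exact.
- move=> x; rewrite inE => Ux; apply: cderiv1_val; apply: is_cderive_conj.
  by case: (sU f 1%N (or_introl erefl)) => + _; exact.
Qed.

Lemma eqjet_sum n (I : Type) (s : seq I) (P : pred I) (F G : I -> R -> C) :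
  (forall i, smooth0 (F i)) -> (forall i, smooth0 (G i)) ->
  (forall i, P i -> eqjet n (F i) (G i)) ->
  eqjet n (fun t => \sum_(i <- s | P i) F i t) (fun t => \sum_(i <- s | P i) G i t).
Proof.
move=> sF sG FG; elim: s => [|i s IH].
  by apply: (@eqjet_ext setT) => [||t _]; [exact: openT | | rewrite !big_nil].
apply: (@eqjet_on setT _ _ _ (fun t => (if P i then F i t else 0)
    + \sum_(i <- s | P i) F i t) (fun t => (if P i then G i t else 0)
    + \sum_(i <- s | P i) G i t)) => //; first exact: openT.
- by move=> t _; rewrite big_cons; case: (P i); rewrite ?add0r.
- by move=> t _; rewrite big_cons; case: (P i); rewrite ?add0r.
- have sm P' F' : (forall i, smooth0 (F' i)) ->
     smooth0 (fun t => if P' i then F' i t else 0).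
    by move=> sF'; case: (P' i) => //; apply: smooth0_const.
  apply: eqjetD; do ?[exact: sm | exact: smooth0_sum | exact: IH].
  by move: (FG i); case: (P i) => // H; apply: H.
Qed.

Lemma cderivZ k z f : smooth0 f ->
  cderiv k (fun t => z * f t) 0 = z * cderiv k f 0.
Proof.
elim: k f => [|k IH] f sf; first by rewrite !cderiv0.
rewrite !cderivS -IH; last exact: smooth0_cder.
have [U [oU U0 sU]] := sf.
apply: (@cderiv_ext U) => //; last by rewrite inE.
move=> x xU; have sz := Cn_on_const 1 z oU; rewrite (cderM oU sz (sU 1%N) xU).
by rewrite {1}/cder (cderiv1_val (is_cderive_const _ _)) mul0r add0r.
Qed.

Lemma cderiv_dilate k f (c : R) : smooth0 f ->
  cderiv k (fun t => f (c * t)) 0 = c%:C ^+ k * cderiv k f 0.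
Proof.
elim: k f => [|k IH] f sf; first by rewrite !cderiv0 expr0 mul1r mulr0.
rewrite !cderivS exprSr -mulrA -cderivZ; last exact: smooth0_cder.
rewrite -IH; last by apply: smooth0M; [exact: smooth0_const | exact: smooth0_cder].
case: sf => U [oU U0 sU].
apply: (@cderiv_ext [set t | U (c * t)]); last by rewrite inE /= mulr0.
  apply: (@open_comp _ _ (fun t : R => c * t)) => // t _.
  by apply: continuousM; [exact: cst_continuous | exact: cvg_id].
move=> x; rewrite inE => Ux; apply: cderiv1_val.
have := @is_cderive_comp_affine _ f c 0 x (cder f (c * x)).
rewrite (_ : (fun t => f (c * t + 0)) = fun t => f (c * t)); last first.
  by apply/funext => t; rewrite addr0.
by apply; rewrite addr0; case: (sU 1%N) => + _; apply.
Qed.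

Lemma eqjet_dilate n f g (c : R) : smooth0 f -> smooth0 g -> eqjet n f g ->
  eqjet n (fun t => f (c * t)) (fun t => g (c * t)).
Proof. by move=> sf sg h k kn; rewrite !cderiv_dilate // h. Qed.

End Smoothness.

(** * Fourier transforms of compactly supported distributions *)

Section FourierOfCompactlySupported.
Variable R : realType.
Notation C := R[i].
Implicit Types (f g : R -> C) (x y h A : R) (z w l : C).

Lemma normC_real x : `|x%:C| = `|x|%:C :> C.
Proof. by rewrite normc_def /= expr0n /= addr0 sqrtr_sqr. Qed.

Lemma normC_le_ReIm z : `|z| <= (`|complex.Re z| + `|complex.Im z|)%:C.
Proof.
rewrite [in X in X <= _](complexE z) (le_trans (ler_normD _ _)) //.
rewrite normrM normC_real normC_real.
have -> : `|'i%C : C| = 1 by rewrite normc_def /= expr0n expr1n add0r sqrtr1.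
by rewrite mul1r raddfD.
Qed.

Lemma Re_le_normC z (B : R) : `|z| <= B%:C -> `|complex.Re z| <= B.
Proof. by move=> h; rewrite -lecR; apply: le_trans h; apply: normc_ge_Re. Qed.

Lemma Im_le_normC z (B : R) : `|z| <= B%:C -> `|complex.Im z| <= B.
Proof.
move=> h; have -> : complex.Im z = complex.Re (- 'i%C * z) by case: z {h} => a b /=;
    rewrite oppr0 mul0r mulN1r opprK add0r.
apply: Re_le_normC; rewrite normrM normrN.
have -> : `|'i%C : C| = 1 by rewrite normc_def /= expr0n expr1n add0r sqrtr1.
by rewrite mul1r.
Qed.

Lemma expi_norm x : `|expi x| = 1 :> C.
Proof. by rewrite normc_def /= cos2Dsin2 sqrtr1. Qed.

Lemma expiD x y : expi (x + y) = expi x * expi y :> C.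
Proof. by rewrite /expi cosD sinD; apply: complex_ext => //=; rewrite addrC. Qed.

Lemma expi0 : expi 0 = 1 :> C.
Proof. by rewrite /expi cos0 sin0. Qed.

Lemma is_derive_quadratic (u : R -> R) x (l M : R) :
  (forall h, 0 < `|h| <= 1 -> `|u (h + x) - u x - h * l| <= M * h ^+ 2) ->
  is_derive x 1 u l.
Proof.
move=> H.
have cv : (fun h => h^-1 *: (u (h *: 1 + x) - u x)) @ 0^' --> l.
  apply/cvgrPdist_le => e e0; near=> h.
  have h0 : h != 0 by near: h; exact: nbhs_dnbhs_neq.
  have hn : 0 < `|h| by rewrite normr_gt0.
  have h1 : `|h| <= 1 by near: h; apply: dnbhs0_le.
  have hM : `|h| <= e / (`|M| + 1) by near: h; apply: dnbhs0_le;
      rewrite divr_gt0 // ltr_wpDl.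
  have := H h; rewrite hn h1 => /(_ isT) Hh.
  have -> : l - h^-1 *: (u (h *: 1 + x) - u x) = - (h^-1 * (u (h + x) - u x - h * l)).
    by rewrite [h *: 1]mulr1 [h^-1 *: _]/(h^-1 * _) mulrBr mulrA mulVf // mul1r opprB.
  rewrite normrN normrM normfV.
  rewrite ler_pdivrMl //; apply: (le_trans Hh).
  rewrite -[h ^+ 2]ger0_norm ?sqr_ge0 // normrX expr2 mulrA [M * _]mulrC -mulrA.
  rewrite ler_pM2l //; apply: (@le_trans _ _ ((`|M| + 1) * `|h|)).
    by rewrite ler_pM2r //; apply: (le_trans (ler_norm M)); rewrite lerDl.
  by rewrite -ler_pdivlMl // ?ltr_wpDl // mulrC.
by apply: DeriveDef; [apply/cvg_ex; exists l | apply/cvg_lim].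
Unshelve. all: by end_near. Qed.

Lemma mean_value_bound (u u' : R -> R) (A K x : R) :
    (forall t : R, is_derive t 1 u (u' t)) ->
  u 0 = 0 -> (forall t, `|t| <= A -> `|u' t| <= K) -> `|x| <= A -> `|u x| <= K * A.
Proof.
move=> du u0 bu xA.
have cu t : {for t, continuous u}.
  by apply/differentiable_continuous/derivable1_diffP; case: (du t).
have cs (D : set R) : {within D, continuous u} by apply: continuous_subspaceT.
have KA c : `|c| <= `|x| -> `|u' c * x| <= K * A.
  move=> cx; rewrite normrM; apply: ler_pM => //.
  by apply: bu; apply: le_trans xA.
have [x0|x0] := leP 0 x.
  have [c cI e] := MVT_segment x0 (fun t _ => du t) (cs _).
  have -> : u x = u' c * x by rewrite -[u x]subr0 -u0 e subr0.
  apply: KA; move: cI; rewrite in_itv /= => /andP[c0 cx].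
  by rewrite !ger0_norm.
have [c cI e] := MVT_segment (ltW x0) (fun t _ => du t) (cs _).
have -> : u x = u' c * x by rewrite -[u x]subr0 -u0 -opprB e sub0r mulrN opprK.
apply: KA; move: cI; rewrite in_itv /= => /andP[cx c0].
by rewrite !ler0_norm ?lerN2 // ltW.
Qed.

Definition bounded_fam A (F : R -> R -> C) := exists K : R,
  forall h x, 0 < `|h| <= 1 -> `|x| <= A -> `|F h x| <= K%:C.

(** The parameter h is the increment of a difference quotient: the derivatives
    in x up to order n are bounded for |x| <= A uniformly in 0 < |h| <= 1. *)
Fixpoint bounded_jets A n (F : R -> R -> C) : Prop :=
  bounded_fam A F /\ if n is m.+1 then bounded_jets A m
      (fun h => cder (F h)) else True.

Lemma bounded_ext A F G : (forall h, 0 < `|h| <= 1 -> F h =1 G h) ->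
  bounded_fam A F -> bounded_fam A G.
Proof. by move=> FG [K bK]; exists K => h x hh xA; rewrite -FG // bK. Qed.

Lemma bounded_jets_ext A n F G : (forall h, 0 < `|h| <= 1 -> F h =1 G h) ->
  bounded_jets A n F -> bounded_jets A n G.
Proof.
elim: n F G => [|n IH] F G FG [bF sF]; split=> //; do ?exact: bounded_ext bF.
by apply: IH sF => h hh; have -> : F h = G h by apply/funext/FG.
Qed.

Lemma bounded_jets_bounded A n F : bounded_jets A n F -> bounded_fam A F.
Proof. by case: n => [|n] []. Qed.

Lemma bounded_jets_pred A n F : bounded_jets A n.+1 F -> bounded_jets A n F.
Proof. by elim: n F => [|n IH] F [bF sF]; split => //; apply: IH. Qed.

Lemma bounded_jets_step A n F G :
    (forall h x, 0 < `|h| <= 1 -> is_cderive (F h) x (G h x)) ->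
  bounded_fam A F -> bounded_jets A n G -> bounded_jets A n.+1 F.
Proof.
move=> dF bF sG; split => //; apply: bounded_jets_ext sG => h hh x.
by rewrite /cder (cderiv1_val (dF h x hh)).
Qed.

(** Families on which a compactly supported distribution is bounded uniformly
    in h, by its continuity estimate. *)
Definition tame A F := (forall n h, Cn_on setT n (F h)) /\ forall n,
    bounded_jets A n F.

Lemma bounded_pos A F : bounded_fam A F -> exists2 K : R, 0 <= K &
  forall h x, 0 < `|h| <= 1 -> `|x| <= A -> `|F h x| <= K%:C.
Proof.
case=> K bK; exists `|K| => // h x hh xA; apply: le_trans (bK h x hh xA) _.
by rewrite lecR ler_norm.
Qed.

Lemma boundedM A F G : bounded_fam A F -> bounded_fam A G ->
  bounded_fam A (fun h x => F h x * G h x).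
Proof.
move=> /bounded_pos[K K0 bK] /bounded_pos[L L0 bL]; exists (K * L) => h x hh xA.
by rewrite normrM rmorphM; apply: ler_pM; auto.
Qed.

Lemma boundedD A F G : bounded_fam A F -> bounded_fam A G ->
  bounded_fam A (fun h x => F h x + G h x).
Proof.
move=> [K bK] [L bL]; exists (K + L) => h x hh xA.
by rewrite raddfD (le_trans (ler_normD _ _)) // lerD; auto.
Qed.

Definition smooth_fam (F : R -> R -> C) := forall n h, Cn_on setT n (F h).

Lemma bounded_jetsD A n F G : smooth_fam F -> smooth_fam G -> bounded_jets A n F ->
    bounded_jets A n G ->
  bounded_jets A n (fun h x => F h x + G h x).
Proof.
elim: n F G => [|n IH] F G sF sG [bF bF'] [bG bG']; first by split=> //;
    exact: boundedD.
apply: bounded_jets_step (boundedD bF bG) _; last first.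
  apply: (IH (fun h => cder (F h)) (fun h => cder (G h))) => // k h.
    by case: (sF k.+1 h).
  by case: (sG k.+1 h).
move=> h x _; apply: is_cderiveD; first by case: (sF 1%N h) => + _; exact.
by case: (sG 1%N h) => + _; exact.
Qed.

Lemma bounded_jetsM A n F G : smooth_fam F -> smooth_fam G -> bounded_jets A n F ->
    bounded_jets A n G ->
  bounded_jets A n (fun h x => F h x * G h x).
Proof.
elim: n F G => [|n IH] F G sF sG bF bG.
  by split=> //; exact: boundedM (bounded_jets_bounded bF) (bounded_jets_bounded bG).
have sF' : smooth_fam (fun h => cder (F h)) by move=> k h; case: (sF k.+1 h).
have sG' : smooth_fam (fun h => cder (G h)) by move=> k h; case: (sG k.+1 h).
apply: (bounded_jets_step _
    (boundedM (bounded_jets_bounded bF) (bounded_jets_bounded bG))).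
  move=> h x _; apply: is_cderiveM; first by case: (sF 1%N h) => + _; exact.
  by case: (sG 1%N h) => + _; exact.
apply: bounded_jetsD.
- by move=> k h; apply: Cn_onM; [exact: openT | exact: sF' | exact: sG].
- by move=> k h; apply: Cn_onM; [exact: openT | exact: sF | exact: sG'].
- by apply: IH => //; [case: bF | exact: bounded_jets_pred].
- by apply: IH => //; [exact: bounded_jets_pred | case: bG].
Qed.

Lemma tameM A F G : tame A F -> tame A G -> tame A (fun h x => F h x * G h x).
Proof.
move=> [sF bF] [sG bG]; split=> n; last exact: bounded_jetsM.
by move=> h; apply: Cn_onM => //; exact: openT.
Qed.

Lemma tame_const A (c : R -> C) (K : R) :
  (forall h, 0 < `|h| <= 1 -> `|c h| <= K%:C) -> tame A (fun h _ => c h).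
Proof.
move=> cK; split=> [n h|n]; first by apply: Cn_on_const; exact: openT.
case: n => [|n]; first by split => //; exists K => h x hh _; apply: cK.
apply: (@bounded_jets_step _ _ _ (fun _ _ => 0)).
- by move=> h x _; apply: is_cderive_const.
- by exists K => h x hh _; apply: cK.
elim: n => [|n IH]; first by split => //; exists 0 => h x _ _; rewrite normr0.
apply: (@bounded_jets_step _ _ _ (fun _ _ => 0)) => //; first by move=> h x _;
    apply: is_cderive_const.
by exists 0 => h x _ _; rewrite normr0.
Qed.

Lemma tame_id A : tame A (fun _ x => x%:C).
Proof.
split=> [n h|n]; first exact: Cn_on_id.
have bA : bounded_fam A (fun _ x => x%:C).
  by exists A => h x _ xA; rewrite normC_real lecR.
case: n => [//|n]; apply: (@bounded_jets_step _ _ _ (fun _ _ => 1)) => //.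
  by move=> h x _; split=> /=; [apply: is_derive_id | apply: is_derive_cst].
by case: (@tame_const A (fun _ => 1) 1) => // h _; rewrite normr1.
Qed.

Lemma is_cderive_expiN c x :
  is_cderive (fun x => expi (- (x * c))) x ((- 'i%C * c%:C) * expi (- (x * c))).
Proof.
have := @is_cderive_comp_affine _ _ (- c) 0 x _ (is_cderive_expi (- c * x + 0)).
rewrite (_ : (fun t => _) = fun t => expi (- (t * c))); last first.
  by apply/funext => t; rewrite addr0 mulNr mulrC.
by apply: is_cderive_eq; rewrite addr0 mulNr mulrC [x * c]mulrC rmorphN /=; ring.
Qed.

Lemma Cn_on_expiN n c : Cn_on setT n (fun x => expi (- (x * c))).
Proof.
rewrite (_ : (fun t => _) = fun t => expi (- c * t + 0));
    first exact: Cn_on_expi_affine.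
by apply/funext => t; rewrite addr0 mulNr mulrC.
Qed.

Lemma tame_expi A (c : R -> R) (K : R) :
  (forall h, 0 < `|h| <= 1 -> `|c h| <= K) ->
  tame A (fun h x => expi (- (x * c h))).
Proof.
move=> cK; have sm : smooth_fam (fun h x => expi (- (x * c h))).
  by move=> n h; apply: Cn_on_expiN.
have bd : bounded_fam A (fun h x => expi (- (x * c h))).
  by exists 1 => h x _ _; rewrite expi_norm.
have gc : tame A (fun h _ => - 'i%C * (c h)%:C).
  apply: (@tame_const _ _ K) => h hh; rewrite normrM normrN normC_real.
  have -> : `|'i%C : C| = 1 by rewrite normc_def /= expr0n expr1n add0r sqrtr1.
  by rewrite mul1r lecR cK.
split => //; elim=> [//|n IH].
apply: (@bounded_jets_step _ _ _
    (fun h x => (- 'i%C * (c h)%:C) * expi (- (x * c h)))) => //.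
  by move=> h x _; apply: is_cderive_expiN.
by apply: (bounded_jetsM _ sm) => //; case: gc.
Qed.

(** Integration in x preserves uniform bounds, by the mean value theorem. *)
Lemma tame_primitive A F G : smooth_fam F -> tame A G ->
  (forall h x, 0 < `|h| <= 1 -> is_cderive (F h) x (G h x)) ->
  (forall h, F h 0 = 0) -> tame A F.
Proof.
move=> sF [sG bG] dF F0; have bF : bounded_fam A F.
  have [K bK] := bounded_jets_bounded (bG 0%N).
  exists (K * A + K * A) => h x hh xA.
  apply: (le_trans (normC_le_ReIm _)); rewrite lecR; apply: lerD.
    apply: (@mean_value_bound (fun t => complex.Re (F h t))
        (fun t => complex.Re (G h t))) => //.
    - by move=> t; case: (dF h t hh).
    - by rewrite F0.
    - by move=> t tA; apply/Re_le_normC/bK.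
  apply: (@mean_value_bound (fun t => complex.Im (F h t))
      (fun t => complex.Im (G h t))) => //.
  - by move=> t; case: (dF h t hh).
  - by rewrite F0.
  - by move=> t tA; apply/Im_le_normC/bK.
by split=> // -[|n]; [split | apply: (bounded_jets_step dF bF)].
Qed.

(** The second-order Taylor remainder of e^{-ixh} in h, divided by h^2. *)
Definition remainder h x : C :=
    (expi (- (x * h)) - 1 + 'i%C * x%:C * h%:C) * (h%:C ^- 2).

(** Uniformity in h comes from integrating twice in x: the second x-derivative
    of the remainder is - e^{-ixh}, which is tame, and the remainder and its
    first x-derivative vanish at x = 0. *)
Lemma tame_remainder A : tame A remainder.
Proof.
have oT := @openT R.
have hb h : 0 < `|h| <= 1 -> `|h| <= 1 by case/andP.
have h0 h : 0 < `|h| <= 1 -> h%:C != 0 :> C.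
  by case/andP; rewrite normr_gt0 => hh _; rewrite eq_complex /= eqxx andbT.
(* delta h is the x-derivative of the remainder. *)
pose delta h x : C := (- 'i%C * (h%:C)^-1) * (expi (- (x * h)) + -1).
have sD : smooth_fam (fun h x => expi (- (x * h)) + -1).
  by move=> n h; apply: Cn_onD => //; [exact: Cn_on_expiN | exact: Cn_on_const].
have sd : smooth_fam delta.
  by move=> n h; apply: Cn_onM => //; exact: Cn_on_const.
have gd : tame A delta.
  apply: (@tame_primitive _ _ (fun h x => -1 * expi (- (x * h)))) => //.
  - apply: tameM; last exact: (@tame_expi _ (fun h => h) 1).
    by apply: (@tame_const _ (fun=> -1) 1) => h _; rewrite normrN normr1.
  - move=> h x hh; have d1 :=
      is_cderiveD (is_cderive_expiN h x) (is_cderive_const (-1) x).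
    apply: is_cderive_eq (is_cderiveM (is_cderive_const (- 'i%C * (h%:C)^-1) x) d1).
    rewrite mul0r add0r addr0 mulrA; congr (_ * _).
    have i2 : ('i%C : C) * 'i%C = -1 by rewrite -expr2 sqr_i.
    rewrite mulrACA mulVf ?h0 // mulr1; rewrite mulrNN i2 //.
  - by move=> h; rewrite /delta mul0r oppr0 expi0 subrr mulr0.
apply: (tame_primitive _ gd).
- move=> n h; apply: Cn_onM => //; last exact: Cn_on_const.
  apply: Cn_onD => //.
  apply: Cn_onM => //; last exact: Cn_on_const.
  by apply: Cn_onM => //; [exact: Cn_on_const | exact: Cn_on_id].
- move=> h x hh; have d1 :=
    is_cderiveD (is_cderive_expiN h x) (is_cderive_const (-1) x).
  have did : is_cderive (fun x : R => x%:C) x 1.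
    by split=> /=; [apply: is_derive_id | apply: is_derive_cst].
  have d2 := is_cderiveM (is_cderiveM (is_cderive_const ('i%C) x) did)
      (is_cderive_const h%:C x).
  apply: is_cderive_eq (is_cderiveM (is_cderiveD d1 d2)
      (is_cderive_const (h%:C ^- 2) x)).
  by rewrite /delta; have := h0 h hh => hn /=; field; exact: hn.
- by move=> h; rewrite /remainder mul0r oppr0 expi0 subrr mulr0 mul0r addr0 mul0r.
Qed.

(** The k-th derivative of e^{-ix xi} with respect to xi. *)
Definition moment k (xi x : R) : C := (- 'i%C * x%:C) ^+ k * expi (- (x * xi)).

Lemma tame_moment A k xi : tame A (fun _ => moment k xi).
Proof.
apply: tameM; last exact: (@tame_expi _ (fun=> xi) `|xi|).
have g1 : tame A (fun _ x => - 'i%C * x%:C).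
  apply: tameM; last exact: tame_id.
  apply: (@tame_const _ (fun=> - 'i%C) 1) => h _; rewrite normrN.
  by rewrite normc_def /= expr0n expr1n add0r sqrtr1.
elim: k => [|k IH].
  rewrite (_ : (fun _ => _) = fun _ _ => 1); last by apply/funext => h;
      apply/funext => x.
  by apply: (@tame_const _ (fun=> 1) 1) => h _; rewrite normr1.
rewrite (_ : (fun _ => _) = fun _ x => (- 'i%C * x%:C) * (- 'i%C * x%:C) ^+ k).
  exact: tameM.
by apply/funext => h; apply/funext => x; rewrite exprS.
Qed.

Lemma moment_taylor k xi h x : h != 0 -> moment k (h + xi) x =
  h%:C ^+ 2 * (moment k xi x * remainder h x)
  + (h%:C * moment k.+1 xi x + 1 * moment k xi x).
Proof.
move=> h0; have hC : h%:C != 0 :> C by rewrite eq_complex /= eqxx andbT.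
rewrite /moment /remainder mulrDr opprD expiD [(_ * _) ^+ k.+1]exprS.
by field; exact: hC.
Qed.

(** One bound for all derivatives up to order N, in the form in which the
    continuity of a distribution is stated. *)
Lemma bounded_jets_uniform A N F : bounded_jets A N F ->
  exists K : R, forall h, 0 < `|h| <= 1 -> forall k x, (k <= N)%N -> `|x| <= A ->
    `|cderiv k (F h) x| <= K%:C.
Proof.
elim: N F => [|N IH] F [/bounded_pos[K K0 bK] bF].
  by exists K => h hh [|k] x // _ xA; rewrite cderiv0 bK.
have [L bL] := IH _ bF; exists (K + `|L|) => h hh [|k] x kN xA.
  by rewrite cderiv0 (le_trans (bK h x hh xA)) // lecR lerDl.
rewrite cderivS; apply: le_trans (bL h hh k x kN xA) _.
by rewrite lecR (le_trans (ler_norm L)) // lerDr.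
Qed.

Variable T : csdist R.

(** Differentiation under the pairing: by linearity the difference quotient
    minus the expected derivative is h times the pairing of T with a tame
    family, hence O(h). *)
Lemma is_cderive_moment k xi :
    is_cderive (fun xi => T (moment k xi)) xi (T (moment k.+1 xi)).
Proof.
have [A [K [N bT]]] := csd_cont T.
have gF : tame A (fun h x => moment k xi x * remainder h x).
  by apply: tameM; [exact: tame_moment | exact: tame_remainder].
have [B bB] := bounded_jets_uniform (gF.2 N).
have sm F h : tame A F -> smooth (F h) by move=> [sF _]; apply: Cn_on_smooth.
have sM j := sm _ 0 (tame_moment A j xi).
have TF h : 0 < `|h| <= 1 ->
    `|T (fun x => moment k xi x * remainder h x)| <= (K * B)%:C.
  by move=> hh; apply: bT; [exact: (sm _ h gF) | exact: (bB h hh)].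
(* The difference quotient is off by h times a bounded pairing. *)
have key h : 0 < `|h| <= 1 ->
    T (moment k (h + xi)) - T (moment k xi) - h%:C * T (moment k.+1 xi) =
   (h ^+ 2)%:C * T (fun x => moment k xi x * remainder h x).
  move=> hh; have h0 : h != 0 by move: hh; rewrite normr_gt0 => /andP[].
  have -> : moment k (h + xi) = fun x => h%:C ^+ 2 * (moment k xi x * remainder h x)
      + (fun x => h%:C * moment k.+1 xi x + moment k xi x) x.
    by apply/funext => x; rewrite (moment_taylor _ _ _ h0) mul1r.
  rewrite csd_linear; [|exact: (sm _ h gF)|]; last first.
    apply: Cn_on_smooth => n; apply: Cn_onD;
        [exact: openT| |exact: (tame_moment A k xi).1 n 0].
    apply: Cn_onM; [exact: openT| apply: Cn_on_const; exact: openT|].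
    exact: (tame_moment A k.+1 xi).1 n 0.
  by rewrite (@csd_linear _ T h%:C (moment k.+1 xi) (moment k xi)) // rmorphXn /=;
      ring.
split; apply: (@is_derive_quadratic _ _ _ (K * B)) => h hh.
  have -> : complex.Re (T (moment k (h + xi))) - complex.Re (T (moment k xi))
     - h * complex.Re (T (moment k.+1 xi)) =
     h ^+ 2 * complex.Re (T (fun x => moment k xi x * remainder h x)).
    have := congr1 (@complex.Re R) (key h hh).
    by rewrite !(Re_add, Re_opp, Re_mul) /= !mul0r !subr0.
  rewrite normrM ger0_norm ?sqr_ge0 // mulrC ler_wpM2r ?sqr_ge0 //.
  exact/Re_le_normC/TF.
have -> : complex.Im (T (moment k (h + xi))) - complex.Im (T (moment k xi))
   - h * complex.Im (T (moment k.+1 xi)) =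
   h ^+ 2 * complex.Im (T (fun x => moment k xi x * remainder h x)).
  have := congr1 (@complex.Im R) (key h hh).
  by rewrite !(Im_add, Im_opp, Im_mul) /= !mul0r !addr0.
rewrite normrM ger0_norm ?sqr_ge0 // mulrC ler_wpM2r ?sqr_ge0 //.
exact/Im_le_normC/TF.
Qed.

(** The easy part of the Paley-Wiener theorem: such Fourier transforms are
    smooth. This is what gives sense to jets of the refinable vector. *)
Lemma Cn_on_csd_fourier n : Cn_on setT n (csd_fourier T).
Proof.
have -> : csd_fourier T = fun xi => T (moment 0 xi).
  apply/funext => xi; rewrite /csd_fourier; congr (T _).
  by apply/funext => x; rewrite /moment expr0 mul1r.
move: {1}0%N => k; elim: n k => [//|n IH] k.
by apply: Cn_on_step (IH k.+1) => [|xi _]; [exact: openT | exact: is_cderive_moment].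
Qed.

End FourierOfCompactlySupported.

(** * Laurent polynomials in z = e^{-i xi} *)

Section Trigonometric.
Variable R : realType.
Notation C := R[i].
Implicit Types (f g : R -> C) (x th : R) (z w : C) (p q : {poly C}).

Lemma expi_neq0 x : expi x != 0 :> C.
Proof. by rewrite -normr_eq0 expi_norm oner_neq0. Qed.

Lemma expiMn k x : expi (k%:R * x) = expi x ^+ k :> C.
Proof.
elim: k => [|k IH]; first by rewrite mul0r expi0.
by rewrite -natr1 mulrDl mul1r expiD IH exprSr.
Qed.

(** The derivation - i z d/dz, which is d/dxi since z = e^{-i xi}. *)
Definition zderiv p : {poly C} := (- 'i%C) *: ('X * p^`()).

(** The shift th serves to read off the jet of a polynomial in z at the point
    th instead of 0. *)
Definition zeval th p : R -> C := fun t => p.[expi (- (t + th))].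

Lemma zevalE th p t : zeval th p t = p.[expi (- (t + th))]. Proof. by []. Qed.

Lemma is_cderive_zeval th p x : is_cderive (zeval th p) x (zeval th (zderiv p) x).
Proof.
have dz : is_cderive (zeval th 'X) x (- 'i%C * zeval th 'X x).
  have -> : zeval th 'X = fun t => expi (-1 * t + - th).
    by apply/funext => t; rewrite zevalE hornerX mulN1r opprD.
  apply: is_cderive_eq (is_cderive_comp_affine (is_cderive_expi _)).
  by rewrite /= rmorphN rmorph1; ring.
elim/poly_ind: p => [|p c IH].
  have -> : zeval th 0 = fun=> 0 by apply/funext => t; rewrite zevalE horner0.
  by apply: is_cderive_eq (is_cderive_const _ _);
      rewrite /zeval /zderiv deriv0 mulr0 scaler0 horner0.
have -> : zeval th (p * 'X + c%:P) = fun t => zeval th p t * zeval th 'X t + c.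
  by apply/funext => t; rewrite /zeval !hornerE.
apply: is_cderive_eq (is_cderiveD (is_cderiveM IH dz) (is_cderive_const _ _)).
by rewrite /zeval /zderiv derivD derivM derivC derivX !hornerE /=; ring.
Qed.

Lemma Cn_on_zeval n th p : Cn_on setT n (zeval th p).
Proof.
elim: n p => [//|n IH] p; apply: Cn_on_step (IH (zderiv p)); first exact: openT.
by move=> x _; apply: is_cderive_zeval.
Qed.

Lemma smooth0_zeval th p : smooth0 (zeval th p).
Proof. by apply: smooth0T => n; apply: Cn_on_zeval. Qed.

Lemma cder_zeval th p : cder (zeval th p) = zeval th (zderiv p).
Proof. by apply/funext => x; apply/cderiv1_val/is_cderive_zeval. Qed.

(** In characteristic 0 differentiation lowers the multiplicity of a root by
    exactly one, and the factor z of the derivation is a unit at w because w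
    is nonzero. *)
Lemma dvdp_XsubC_exp_deriv N w p : w != 0 ->
  (('X - w%:P) ^+ N.+1 %| p) = (p.[w] == 0) && (('X - w%:P) ^+ N %| zderiv p).
Proof.
move=> w0; rewrite /zderiv dvdpZr ?oppr_eq0; last
    by rewrite eq_complex /= eqxx oner_eq0.
have cX : coprimep (('X - w%:P) ^+ N) 'X.
  by rewrite coprimep_expl // coprimep_sym coprimep_XsubC rootX.
rewrite Gauss_dvdpr //.
apply/idP/andP => [|[/eqP p0 dp]].
  case/dvdpP => q ->; split; first
      by rewrite hornerM horner_exp !hornerE subrr expr0n mulr0.
  rewrite derivM deriv_exp derivXsubC mul1r /=; apply: dvdp_add.
    by apply: dvdp_mull; rewrite exprS dvdp_mull.
  by rewrite dvdp_mull // -mulr_natr dvdp_mulr.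
have /factor_theorem [q qE] : root p w by apply/eqP.
rewrite qE exprSr dvdp_mul2r ?polyXsubC_eq0 //.
have [->|q0] := eqVneq q 0; first exact: dvdp0.
have [k [g gw qg]] := multiplicity_XsubC q w.
move: gw; rewrite q0 /= => gw.
move: dp; rewrite qE qg -mulrA -exprSr derivM deriv_exp derivXsubC mul1r /= => dp.
have [Nk|kN] := leqP N k; first by rewrite dvdp_mull // dvdp_exp2l.
have : ('X - w%:P) ^+ k.+1 %| g * ('X - w%:P) ^+ k *+ k.+1.
  have d1 : ('X - w%:P) ^+ k.+1 %| g^`() * ('X - w%:P) ^+ k.+1 by rewrite dvdp_mull.
  rewrite -mulrnAr -(dvdp_addr _ d1); apply: dvdp_trans dp.
  exact: dvdp_exp2l.
rewrite -mulrnAl exprS dvdp_mul2r ?expf_neq0 ?polyXsubC_eq0 //.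
by rewrite dvdp_XsubCl /root hornerMn -mulr_natr mulf_eq0 pnatr_eq0 orbF -/(root _ _)
    (negbTE gw).
Qed.

Lemma cder_const z : cder (fun=> z : C) = fun=> 0.
Proof. by apply/funext => x; apply/cderiv1_val/is_cderive_const. Qed.

Lemma cderiv_zero k : cderiv k (fun=> 0 : C) = fun=> 0.
Proof. by elim: k => [|k IH]; rewrite ?cderiv0 // cderivS cder_const. Qed.

(** The dictionary between analysis and algebra: z - e^{-i th} has a simple
    zero at xi = th, so vanishing to order N at th is divisibility by its N-th
    power. *)
Lemma eqjet_zeval0 N th p :
  eqjet N (zeval th p) (fun=> 0) <-> ('X - (expi (- th))%:P) ^+ N %| p.
Proof.
elim: N p => [|N IH] p; first by split=> // _; rewrite expr0 dvd1p.
rewrite dvdp_XsubC_exp_deriv ?expi_neq0 //; split.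
  case/eqjetS => h0 h1; apply/andP; split.
    by rewrite -h0 zevalE add0r.
  apply/IH; move: h1; rewrite cder_zeval.
  by rewrite cder_const.
case/andP => /eqP h0 /IH h1; apply/eqjetS; split; first by rewrite zevalE add0r.
rewrite cder_zeval.
by rewrite cder_const.
Qed.

(** Every jet is the jet of a polynomial in z: the power (z - 1)^N vanishes to
    order exactly N at xi = 0, so a multiple of it corrects the N-th
    derivative without changing the lower ones. *)
Lemma zeval_approx N f : smooth0 f -> exists p, eqjet N (zeval 0 p) f.
Proof.
move=> sf; elim: N => [|N [p pf]]; first by exists 0.
pose b : {poly C} := ('X - 1) ^+ N.
have e0 : (expi (- 0))%:P = 1 :> {poly C} by rewrite oppr0 expi0.
have b0 : eqjet N (zeval 0 b) (fun=> 0) by apply/eqjet_zeval0; rewrite e0.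
(* Otherwise (z - 1)^(N + 1) would divide (z - 1)^N. *)
have bN : cderiv N (zeval 0 b) 0 != 0.
  apply/eqP => bN; have : eqjet N.+1 (zeval 0 b) (fun=> 0).
    move=> k; rewrite ltnS leq_eqVlt => /orP[/eqP ->|/b0 //].
    by rewrite bN cderiv_zero.
  move/eqjet_zeval0; rewrite e0 /b => /dvdp_leq.
  rewrite -polyC1 expf_neq0 ?polyXsubC_eq0 // !size_exp_XsubC ltnn.
  by move/(_ isT).
pose c := (cderiv N f 0 - cderiv N (zeval 0 p) 0) / cderiv N (zeval 0 b) 0.
exists (p + c *: b).
have -> : zeval 0 (p + c *: b) = fun t => zeval 0 p t + c * zeval 0 b t.
  by apply/funext => t; rewrite /zeval !hornerE.
have sb := smooth0_zeval 0 b; have sp := smooth0_zeval 0 p.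
have scb : smooth0 (fun t => c * zeval 0 b t) by apply: smooth0M => //;
    exact: smooth0_const.
move=> k; rewrite ltnS leq_eqVlt cderivD // cderivZ // => /orP[/eqP ->|kN].
  by rewrite /c divfK // addrC subrK.
by rewrite pf // b0 // cderiv_zero mulr0 addr0.
Qed.

(** A Laurent polynomial in z is z^(-K) times a polynomial; the negative power
    is kept apart so that divisibility can be discussed in {poly C}. *)
Definition trig f := exists (K : nat) p, forall t, f t =
    expi (K%:R * t) * zeval 0 p t.

Lemma trig_widen f K p : (forall t, f t = expi (K%:R * t) * zeval 0 p t) ->
  forall L, exists q, forall t, f t = expi ((K + L)%:R * t) * zeval 0 q t.
Proof.
move=> fE L; exists ('X^L * p) => t.
rewrite fE /zeval hornerM hornerXn addr0 natrD mulrDl expiD -!mulrA; congr (_ * _).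
rewrite mulrA expiMn -exprMn -expiD subrr expi0 expr1n mul1r //.
Qed.

Lemma trigD f g : trig f -> trig g -> trig (fun t => f t + g t).
Proof.
move=> [K [p fE]] [L [q gE]].
have [p' fE'] := trig_widen fE L; have [q' gE'] := trig_widen gE K.
exists (K + L)%N, (p' + q') => t.
by rewrite fE' gE' addnC -mulrDr /zeval hornerD.
Qed.

Lemma trigM f g : trig f -> trig g -> trig (fun t => f t * g t).
Proof.
move=> [K [p fE]] [L [q gE]]; exists (K + L)%N, (p * q) => t.
by rewrite fE gE /zeval hornerM natrD mulrDl expiD; ring.
Qed.

Lemma trig_zeval p : trig (zeval 0 p).
Proof. by exists 0%N, p => t; rewrite mul0r expi0 mul1r. Qed.

Lemma trig_const z : trig (fun=> z).
Proof. by exists 0%N, z%:P => t; rewrite mul0r expi0 mul1r /zeval hornerC. Qed.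

Lemma trig_ext f g : f =1 g -> trig f -> trig g.
Proof. by move=> /funext ->. Qed.

Lemma trig_sum (I : Type) (s : seq I) (P : pred I) (F : I -> R -> C) :
  (forall i, trig (F i)) -> trig (fun t => \sum_(i <- s | P i) F i t).
Proof.
move=> tF; elim: s => [|i s IH].
  by apply: trig_ext (trig_const 0) => t; rewrite big_nil.
apply: (@trig_ext (fun t => (if P i then F i t else 0) + \sum_(i <- s | P i) F i t)).
  by move=> t; rewrite big_cons; case: (P i); rewrite ?add0r.
by apply: trigD => //; case: (P i) => //; apply: trig_const.
Qed.

Lemma trig_dilate d f : trig f -> trig (fun t => f (d%:R * t)).
Proof.
move=> [K [p fE]]; exists (K * d)%N, (p \Po 'X^d) => t.
rewrite fE /zeval horner_comp hornerXn natrM mulrA; congr (_ * _.[_]).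
by rewrite !addr0 -mulrN expiMn.
Qed.

Lemma trig_expi (k : int) : trig (fun t => expi (- (k%:~R * t))).
Proof.
case: k => k.
  exists 0%N, 'X^k => t.
  by rewrite mul0r expi0 mul1r /zeval hornerXn addr0 -expiMn mulrN.
exists k.+1, 1 => t.
by rewrite /zeval hornerC mulr1 NegzE mulrNz mulNr opprK.
Qed.

Lemma Cn_on_trig n f : trig f -> Cn_on setT n f.
Proof.
move=> [K [p /funext ->]]; apply: Cn_onM; [exact: openT| |exact: Cn_on_zeval].
rewrite (_ : (fun t => _) = fun t => expi (K%:R * t + 0));
    first exact: Cn_on_expi_affine.
by apply/funext => t; rewrite addr0.
Qed.

Lemma smooth0_trig f : trig f -> smooth0 f.
Proof. by move=> tf; apply: smooth0T => n; apply: Cn_on_trig. Qed.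

Lemma trig_fourier (r1 r2 : nat) (u : l0 R r1 r2) i j :
    trig (fun t => fourier u t i j).
Proof.
apply: (@trig_ext (fun t => \sum_(k <- finsupp u) expi (- (k%:~R * t)) * u k i j)).
  by move=> t; rewrite /fourier summxE; apply: eq_bigr => k _; rewrite mxE.
by apply: trig_sum => k; apply: trigM; [exact: trig_expi | exact: trig_const].
Qed.

End Trigonometric.

(** * Matrices of trigonometric polynomials and their jets *)

Section TrigMatrices.
Variable R : realType.
Notation C := R[i].

Lemma fourier_widen r1 r2 (u : l0 R r1 r2) (S : {fset int}) t :
  (finsupp u `<=` S)%fset ->
  fourier u t = \sum_(k <- S) expi (- (k%:~R * t)) *: u k.
Proof.
move=> uS; rewrite /fourier; apply: big_fset_incl => // k _.
by move/fsfun_dflt => ->; rewrite scaler0.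
Qed.

Definition is_fourier r1 r2 (F : R -> 'M[C]_(r1, r2)) :=
  exists u : l0 R r1 r2, forall t, F t = fourier u t.

Lemma is_fourier_monomial r1 r2 (k : int) (A : 'M[C]_(r1, r2)) :
  is_fourier (fun t => expi (- (k%:~R * t)) *: A).
Proof.
exists [fsfun k' in [fset k]%fset => A]%fset => t.
rewrite (@fourier_widen _ _ _ [fset k]%fset); last exact: finsupp_sub.
by rewrite big_seq_fset1 fsfunE inE eqxx.
Qed.

Lemma is_fourierD r1 r2 (F G : R -> 'M[C]_(r1, r2)) :
  is_fourier F -> is_fourier G -> is_fourier (fun t => F t + G t).
Proof.
move=> [u uE] [v vE].
exists [fsfun k in (finsupp u `|` finsupp v)%fset => (u k + v k)%R]%fset => t.
rewrite (@fourier_widen _ _ _ (finsupp u `|` finsupp v)%fset);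
    last exact: finsupp_sub.
rewrite uE vE (@fourier_widen _ _ u (finsupp u `|` finsupp v)%fset) ?fsubsetUl //.
rewrite (@fourier_widen _ _ v (finsupp u `|` finsupp v)%fset) ?fsubsetUr //.
rewrite -big_split /= big_seq [RHS]big_seq; apply: eq_bigr => k kS.
by rewrite -scalerDr fsfunE kS.
Qed.

Lemma is_fourier_ext r1 r2 (F G : R -> 'M[C]_(r1, r2)) :
  F =1 G -> is_fourier F -> is_fourier G.
Proof. by move=> /funext ->. Qed.

Lemma is_fourier_sum r1 r2 (I : Type) (s : seq I) (F : I -> R -> 'M[C]_(r1, r2)) :
  (forall i, is_fourier (F i)) -> is_fourier (fun t => \sum_(i <- s) F i t).
Proof.
move=> sF; elim: s => [|i s IH].
  apply: is_fourier_ext (is_fourier_monomial 0 0) => t.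
  by rewrite big_nil scaler0.
by apply: is_fourier_ext (is_fourierD (sF i) IH) => t; rewrite big_cons.
Qed.

Lemma trig_is_fourier r1 r2 (F : R -> 'M[C]_(r1, r2)) :
  (forall i j, trig (fun t => F t i j)) -> is_fourier F.
Proof.
move=> tF; apply: (@is_fourier_ext _ _
    (fun t => \sum_(ij <- index_enum ('I_r1 * 'I_r2)%type)
    F t ij.1 ij.2 *: delta_mx ij.1 ij.2)).
  by move=> t; rewrite [RHS]matrix_sum_delta pair_bigA.
apply: is_fourier_sum => -[i j] /=; have [K [p fE]] := tF i j.
apply: (@is_fourier_ext _ _ (fun t => \sum_(l <- iota 0 (size p))
    expi (- ((l%:Z - K%:Z)%:~R * t)) *: (p`_l *: delta_mx i j))).
  move=> t; rewrite fE /zeval addr0 horner_coef mulr_sumr scaler_suml.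
  rewrite -[in RHS](big_mkord xpredT
      (fun l => (expi (K%:R * t) *
      (p`_l * expi (- t) ^+ l)) *: delta_mx i j)) /index_iota subn0.
  apply: eq_bigr => l _; rewrite scalerA; congr (_ *: _).
  rewrite -expiMn mulrCA -expiD [RHS]mulrC; congr (expi _ * _).
  by rewrite rmorphB /= mulrBl opprB mulrN.
by apply: is_fourier_sum => l; apply: is_fourier_monomial.
Qed.

Definition smooth_mx r1 r2 (F : R -> 'M[C]_(r1, r2)) :=
  forall i j, smooth0 (fun t => F t i j).

Lemma eqOP r1 r2 n (F G : R -> 'M[C]_(r1, r2)) :
  eqO n F G <-> forall i j, eqjet n (fun t => F t i j) (fun t => G t i j).
Proof. by split=> [h i j k kn|h k kn i j]; apply: h. Qed.

Lemma eqO_sym r1 r2 n (F G : R -> 'M[C]_(r1, r2)) : eqO n F G -> eqO n G F.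
Proof. by move=> h k kn i j; rewrite h. Qed.

Lemma eqO_trans r1 r2 n (G F H : R -> 'M[C]_(r1, r2)) :
  eqO n F G -> eqO n G H -> eqO n F H.
Proof. by move=> h1 h2 k kn i j; rewrite h1 ?h2. Qed.

Lemma eqO_le r1 r2 m n (F G : R -> 'M[C]_(r1, r2)) :
  (m <= n)%N -> eqO n F G -> eqO m F G.
Proof. by move=> mn h k km; apply: h; apply: leq_trans mn. Qed.

Lemma smooth_mx_ext r1 r2 (F G : R -> 'M[C]_(r1, r2)) : F =1 G -> smooth_mx F ->
    smooth_mx G.
Proof. by move=> /funext ->. Qed.

Lemma eqO_ext r1 r2 n (F G : R -> 'M[C]_(r1, r2)) : F =1 G -> eqO n F G.
Proof. by move=> /funext ->. Qed.

Lemma smooth_mxM r1 r2 r3 (F : R -> 'M[C]_(r1, r2)) (G : R -> 'M[C]_(r2, r3)) :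
  smooth_mx F -> smooth_mx G -> smooth_mx (fun t => F t *m G t).
Proof.
move=> sF sG i j; rewrite (_ : (fun t => _) = fun t => \sum_k F t i k * G t k j).
  by apply: smooth0_sum => k; apply: smooth0M.
by apply/funext => t; rewrite mxE.
Qed.

Lemma eqOM r1 r2 r3 n (F F' : R -> 'M[C]_(r1, r2)) (G G' : R -> 'M[C]_(r2, r3)) :
  smooth_mx F -> smooth_mx F' -> smooth_mx G -> smooth_mx G' -> eqO n F F' ->
      eqO n G G' ->
  eqO n (fun t => F t *m G t) (fun t => F' t *m G' t).
Proof.
move=> sF sF' sG sG' /eqOP FF /eqOP GG; apply/eqOP => i j.
rewrite (_ : (fun t => _) = fun t => \sum_k F t i k * G t k j); last first.
  by apply/funext => t; rewrite mxE.
rewrite (_ : (fun t => (F' t *m G' t) i j) = fun t => \sum_k F' t i k * G' t k j);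
    last first.
  by apply/funext => t; rewrite mxE.
by apply: eqjet_sum => k; [apply: smooth0M | apply: smooth0M | move=> _;
    apply: eqjetM].
Qed.

Lemma eqOMl r1 r2 r3 n (F : R -> 'M[C]_(r1, r2)) (G G' : R -> 'M[C]_(r2, r3)) :
  smooth_mx F -> smooth_mx G -> smooth_mx G' -> eqO n G G' ->
  eqO n (fun t => F t *m G t) (fun t => F t *m G' t).
Proof. by move=> *; apply: eqOM. Qed.

Lemma eqOMr r1 r2 r3 n (F F' : R -> 'M[C]_(r1, r2)) (G : R -> 'M[C]_(r2, r3)) :
  smooth_mx F -> smooth_mx F' -> smooth_mx G -> eqO n F F' ->
  eqO n (fun t => F t *m G t) (fun t => F' t *m G t).
Proof. by move=> *; apply: eqOM. Qed.

Lemma smooth_mxD r1 r2 (F G : R -> 'M[C]_(r1, r2)) :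
  smooth_mx F -> smooth_mx G -> smooth_mx (fun t => F t + G t).
Proof.
move=> sF sG i j; rewrite (_ : (fun t => _) = fun t => F t i j + G t i j).
  exact: smooth0D.
by apply/funext => t; rewrite mxE.
Qed.

Lemma eqOD r1 r2 n (F F' G G' : R -> 'M[C]_(r1, r2)) :
  smooth_mx F -> smooth_mx F' -> smooth_mx G -> smooth_mx G' -> eqO n F F' ->
      eqO n G G' ->
  eqO n (fun t => F t + G t) (fun t => F' t + G' t).
Proof.
move=> sF sF' sG sG' /eqOP FF /eqOP GG; apply/eqOP => i j.
rewrite (_ : (fun t => _) = fun t => F t i j + G t i j); last first.
  by apply/funext => t; rewrite mxE.
rewrite (_ : (fun t => (F' t + G' t) i j) = fun t => F' t i j + G' t i j); last first.
  by apply/funext => t; rewrite mxE.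
exact: eqjetD.
Qed.

Lemma smooth_mx_const r1 r2 (A : 'M[C]_(r1, r2)) : smooth_mx (fun=> A).
Proof. by move=> i j; apply: smooth0_const. Qed.

Lemma smooth_mxZ r1 r2 (f : R -> C) (F : R -> 'M[C]_(r1, r2)) :
  smooth0 f -> smooth_mx F -> smooth_mx (fun t => f t *: F t).
Proof.
move=> sf sF i j; rewrite (_ : (fun t => _) = fun t => f t * F t i j).
  exact: smooth0M.
by apply/funext => t; rewrite mxE.
Qed.

Lemma eqOZ r1 r2 n (f f' : R -> C) (F F' : R -> 'M[C]_(r1, r2)) :
  smooth0 f -> smooth0 f' -> smooth_mx F -> smooth_mx F' -> eqjet n f f' ->
      eqO n F F' ->
  eqO n (fun t => f t *: F t) (fun t => f' t *: F' t).
Proof.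
move=> sf sf' sF sF' ff /eqOP FF; apply/eqOP => i j.
rewrite (_ : (fun t => _) = fun t => f t * F t i j); last first.
  by apply/funext => t; rewrite mxE.
rewrite (_ : (fun t => (f' t *: F' t) i j) = fun t => f' t * F' t i j); last first.
  by apply/funext => t; rewrite mxE.
exact: eqjetM.
Qed.

Lemma smooth_mx_adj r1 r2 (F : R -> 'M[C]_(r1, r2)) : smooth_mx F ->
    smooth_mx (fun t => (F t)^t*).
Proof.
move=> sF i j; rewrite (_ : (fun t => _) = fun t => ((F t j i)^*)%C).
  exact: smooth0_conj.
by apply/funext => t; rewrite !mxE.
Qed.

Lemma eqO_adj r1 r2 n (F G : R -> 'M[C]_(r1, r2)) : smooth_mx F -> smooth_mx G ->
  eqO n F G -> eqO n (fun t => (F t)^t*) (fun t => (G t)^t*).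
Proof.
move=> sF sG /eqOP FG; apply/eqOP => i j.
rewrite (_ : (fun t => _) = fun t => ((F t j i)^*)%C); last first.
  by apply/funext => t; rewrite !mxE.
rewrite (_ : (fun t => (G t)^t* i j) = fun t => ((G t j i)^*)%C); last first.
  by apply/funext => t; rewrite !mxE.
exact: eqjet_conj.
Qed.

Lemma smooth_mx_dilate r1 r2 c (F : R -> 'M[C]_(r1, r2)) : smooth_mx F ->
    smooth_mx (fun t => F (c * t)).
Proof. by move=> sF i j; apply: (smooth0_affine c (sF i j)). Qed.

Lemma eqO_dilate r1 r2 n c (F G : R -> 'M[C]_(r1, r2)) : smooth_mx F -> smooth_mx G ->
  eqO n F G -> eqO n (fun t => F (c * t)) (fun t => G (c * t)).
Proof.
move=> sF sG /eqOP FG; apply/eqOP => i j.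
exact: (@eqjet_dilate _ _ (fun t => F t i j) (fun t => G t i j)).
Qed.

Lemma smooth_mx_fourier r1 r2 (u : l0 R r1 r2) : smooth_mx (fourier u).
Proof. by move=> i j; apply/smooth0_trig/trig_fourier. Qed.

Lemma smooth_mx_fourier_shift r1 r2 (u : l0 R r1 r2) c :
    smooth_mx (fun t => fourier u (t + c)).
Proof.
move=> i j; rewrite (_ : (fun t => _) =
    fun t => \sum_(k <- finsupp u) expi ((- k%:~R) * t + - (k%:~R * c)) * u k i j).
  apply: smooth0_sum => k; apply: smooth0M;
      [exact: smooth0_expi | exact: smooth0_const].
apply/funext => t; rewrite /fourier summxE; apply: eq_bigr => k _.
by rewrite mxE mulrDr opprD mulNr.
Qed.

(** Matrices over {poly C} evaluated at z = e^{-i xi}. An invertible matrix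
    over {poly C} thus yields a strongly invertible matrix of trigonometric
    polynomials. The + 0 makes entries convertible to zeval 0. *)
Definition zevalmx r1 r2 (P : 'M[{poly C}]_(r1, r2)) (t : R) : 'M[C]_(r1, r2) :=
  map_mx (horner_eval (expi (- (t + 0)))) P.

Lemma zevalmxE r1 r2 (P : 'M[{poly C}]_(r1, r2)) t i j : zevalmx P t i j =
    zeval 0 (P i j) t.
Proof. by rewrite mxE. Qed.

Lemma smooth_mx_zevalmx r1 r2 (P : 'M[{poly C}]_(r1, r2)) : smooth_mx (zevalmx P).
Proof.
move=> i j; rewrite (_ : (fun t => _) = zeval 0 (P i j)); first exact: smooth0_zeval.
by apply/funext => t; rewrite zevalmxE.
Qed.

Lemma zevalmx_approx r1 r2 N (F : R -> 'M[C]_(r1, r2)) : smooth_mx F ->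
  exists P : 'M[{poly C}]_(r1, r2), eqO N (zevalmx P) F.
Proof.
move=> sF.
have /choice[p pE] : forall ij : 'I_r1 * 'I_r2, exists p,
    eqjet N (zeval 0 p) (fun t => F t ij.1 ij.2).
  by move=> ij; apply/zeval_approx/sF.
exists (\matrix_(i, j) p (i, j)); apply/eqOP => i j.
rewrite (_ : (fun t => zevalmx _ t i j) = zeval 0 (p (i, j)));
    first exact: (pE (i, j)).
by apply/funext => t; rewrite zevalmxE mxE.
Qed.

Lemma zevalmxM r1 r2 r3 (P : 'M[{poly C}]_(r1, r2)) (Q : 'M_(r2, r3)) t :
  zevalmx (P *m Q) t = zevalmx P t *m zevalmx Q t.
Proof. exact: map_mxM. Qed.

Lemma zevalmx1 r1 t : zevalmx (1%:M : 'M[{poly C}]_r1) t = 1%:M.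
Proof. exact: map_mx1. Qed.

Lemma zevalmx0 r1 r2 t : zevalmx (0 : 'M[{poly C}]_(r1, r2)) t = 0.
Proof. exact: map_mx0. Qed.

Lemma zevalmx_const r1 r2 (A : 'M[C]_(r1, r2)) t : zevalmx (map_mx polyC A) t = A.
Proof. by apply/matrixP => i j; rewrite !mxE /horner_eval hornerC. Qed.

Lemma zevalmx_block m1 m2 n1 n2 (A : 'M[{poly C}]_(m1, n1)) (B : 'M_(m1, n2))
  (D : 'M_(m2, n1)) (E : 'M_(m2, n2)) t :
  zevalmx (block_mx A B D E) t =
      block_mx (zevalmx A t) (zevalmx B t) (zevalmx D t) (zevalmx E t).
Proof. exact: map_block_mx. Qed.

Lemma zevalmx_is_fourier r1 r2 (P : 'M[{poly C}]_(r1, r2)) : is_fourier (zevalmx P).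
Proof.
apply: trig_is_fourier => i j; apply: trig_ext (trig_zeval (P i j)) => t.
by rewrite zevalmxE.
Qed.

End TrigMatrices.

(** * Zeros at roots of unity and divisibility *)

Section Factorization.
Variable R : realType.
Notation C := R[i].
Implicit Types (f g : R -> C) (x th : R) (z w : C).

(** The k-th derivative of f (d t) at 0 is d^k times that of f, and d^k is not
    1 for k > 0. *)
Lemma dilation_invariant_jet m d f : (2 <= d)%N -> smooth0 f -> f 0 = 1 ->
  eqjet m (fun t => f (d%:R * t)) f -> eqjet m f (fun=> 1).
Proof.
move=> d2 sf f0 h [|k] km; first by rewrite !cderiv0.
rewrite (_ : cderiv k.+1 (fun=> 1) 0 = 0); last
    by rewrite cderivS cder_const cderiv_zero.
have := h _ km; rewrite cderiv_dilate // => e; apply/eqP.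
have : ((d%:R : R)%:C ^+ k.+1 - 1) * cderiv k.+1 f 0 = 0.
  by rewrite mulrBl mul1r e subrr.
move/eqP; rewrite mulf_eq0 => /orP[|//].
rewrite subr_eq0 rmorph_nat -natrX -[1]/(1%:R) eqr_nat => /eqP e1.
by have := ltn_expl k.+1 d2; rewrite e1.
Qed.

Lemma expi_neq1 x : 0 < x < 2 * pi -> expi (- x) != 1 :> C.
Proof.
case/andP=> x0 x2; apply/eqP => /(congr1 (@complex.Re R)) /=; rewrite cosN => cx.
have sx : 0 < sin (x / 2) by apply: sin_gt0_pi; lra.
(* cos x = 1 would force cos (x / 2)^2 = 1, whereas 0 < x / 2 < pi. *)
have e2 : (x / 2) *+ 2 = x by rewrite -mulr_natr divfK.
have := cos_mulr2n (x / 2); rewrite e2 cx -mulr_natr => e.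
by have := cos2Dsin2 (x / 2); nra.
Qed.

Definition omega d : C := expi (- (2 * pi / d%:R)).

Lemma omega_exp d k : omega d ^+ k = expi (- (2 * pi * k%:R / d%:R)).
Proof. by rewrite -expiMn; congr expi; ring. Qed.

Lemma omega_primitive d : (0 < d)%N -> d.-primitive_root (omega d).
Proof.
move=> d0; rewrite /primitive_root_of_unity d0 /=; apply/forallP => i.
have dR : (0 : R) < d%:R by rewrite ltr0n.
apply/eqP; have [id|id] := eqVneq i.+1 d.
  apply/unity_rootP; rewrite id omega_exp mulfK ?lt0r_neq0 //.
  rewrite /expi cosN sinN mulrC mulr_natr cos2pi sin2pi oppr0 //.
apply/negP => /unity_rootP; rewrite omega_exp; apply/eqP/expi_neq1.
have ltd : (i.+1 < d)%N by rewrite ltn_neqAle id ltn_ord.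
have p0 := pi_gt0 R.
rewrite divr_gt0 ?mulr_gt0 ?ltr0n //= ltr_pdivrMr // ltr_pM2l ?mulr_gt0 //.
by rewrite ltr_nat.
Qed.

Lemma prod_omega d z : (0 < d)%N ->
  \prod_(w <- [seq omega d ^+ k | k <- iota 0 d]) (z - w) = z ^+ d - 1.
Proof.
move=> d0; have := congr1 (fun p => p.[z]) (factor_Xn_sub_1 (omega_primitive d0)).
rewrite !hornerE => <-; rewrite horner_prod big_map /index_iota subn0.
by apply: eq_bigr => i _; rewrite !hornerE.
Qed.

(** The factorization of z^d - 1 with the factor z - 1 removed: the polynomial
    1 + z + ... + z^(d-1) is the one whose powers appear in sum rules. *)
Lemma prod_omega_sum d : (0 < d)%N ->
  \prod_(w <- [seq omega d ^+ k | k <- iota 1 d.-1]) ('X - w%:P) = \sum_(k < d) 'X^k.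
Proof.
move=> d0; have := factor_Xn_sub_1 (omega_primitive d0).
have nz : 'X - 1 != 0 :> {poly C} by rewrite -polyC1 polyXsubC_eq0.
rewrite subrX1 /index_iota subn0; case: d d0 => // d _.
rewrite big_cons expr0 polyC1 => /(mulfI nz) <-.
by rewrite big_map.
Qed.

Lemma dvdp_prod_exp m (s : seq C) (p : {poly C}) : uniq s ->
  (forall w, w \in s -> ('X - w%:P) ^+ m %| p) ->
  (\prod_(w <- s) ('X - w%:P)) ^+ m %| p.
Proof.
elim: s => [|w s IH]; first by rewrite big_nil expr1n dvd1p.
rewrite cons_uniq => /andP[ws us] h; rewrite big_cons exprMn Gauss_dvdp.
  by rewrite h ?mem_head // IH // => z zs; rewrite h // inE zs orbT.
apply: coprimep_expl; apply: coprimep_expr.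
by rewrite coprimep_sym coprimep_XsubC root_prod_XsubC.
Qed.

(** The powers (z - w)^m at distinct points w are coprime, so their product
    divides the polynomial part of f, and the quotient is again a Laurent
    polynomial. *)
Lemma trig_vanish m f (s : seq C) : trig f -> uniq s ->
  (forall w, w \in s -> exists2 th, w = expi (- th) &
      eqjet m (fun t => f (t + th)) (fun=> 0)) ->
  exists2 g, trig g & forall t, f t =
      (\prod_(w <- s) ('X - w%:P)).[expi (- t)] ^+ m * g t.
Proof.
move=> [K [p fE]] us h.
have /dvdpP [q pE] : (\prod_(w <- s) ('X - w%:P)) ^+ m %| p.
  apply: dvdp_prod_exp => // w /h [th -> fth]; apply/eqjet_zeval0.
  (* The unimodular factor has no zero, so p vanishes where f does. *)
  have e : zeval th p = fun t => expi ((- K%:R) * t + - (K%:R * th)) * f (t + th).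
    apply/funext => t; rewrite fE /zeval addr0 mulrA -expiD.
    by rewrite mulrDr mulNr -opprD addNr expi0 mul1r.
  have sf : smooth0 (fun t => f (t + th)).
    apply: smooth0T => n; have :=
        Cn_on_affine 1 th (@openT R) (Cn_on_trig n (ex_intro _ K (ex_intro _ p fE))).
    rewrite (_ : (fun t => _) = fun t => f (t + th)) //.
    by apply/funext => t; rewrite mul1r.
  rewrite e; apply: (@eqjet_trans _ _
      (fun t => expi ((- K%:R) * t + - (K%:R * th)) * 0)).
    by apply: eqjetM => //; [exact: smooth0_expi | exact: smooth0_expi | exact: smooth0_const].
  by apply: (@eqjet_ext _ setT) => [||t _]; [exact: openT | | rewrite mulr0].
exists (fun t => expi (K%:R * t) * zeval 0 q t); first by exists K, q.
by move=> t; rewrite fE pE /zeval addr0 hornerM horner_exp; ring.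
Qed.

End Factorization.

Section MatrixTrig.
Variable R : realType.
Notation C := R[i].

Definition trig_mx r1 r2 (F : R -> 'M[C]_(r1, r2)) := forall i j,
    trig (fun t => F t i j).

Lemma trig_mxM r1 r2 r3 (F : R -> 'M[C]_(r1, r2)) (G : R -> 'M[C]_(r2, r3)) :
  trig_mx F -> trig_mx G -> trig_mx (fun t => F t *m G t).
Proof.
move=> sF sG i j; apply: (@trig_ext _ (fun t => \sum_k F t i k * G t k j)).
  by move=> t; rewrite mxE.
by apply: trig_sum => k; apply: trigM.
Qed.

Lemma trig_mx_zevalmx r1 r2 (P : 'M[{poly C}]_(r1, r2)) : trig_mx (zevalmx P).
Proof.
by move=> i j; apply: trig_ext (trig_zeval (P i j)) => t; rewrite zevalmxE.
Qed.

Lemma trig_mx_dilate r1 r2 d (F : R -> 'M[C]_(r1, r2)) :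
  trig_mx F -> trig_mx (fun t => F (d%:R * t)).
Proof. by move=> sF i j; apply: (trig_dilate d (sF i j)). Qed.

Lemma zevalmx_periodic r1 r2 (P : 'M[{poly C}]_(r1, r2)) t g :
  zevalmx P (t + 2 * pi * g%:R) = zevalmx P t.
Proof.
rewrite /zevalmx; congr (map_mx (horner_eval _) P).
have e1 : expi (- (2 * pi)) = 1 :> C.
  by rewrite /expi cosN sinN mulrC mulr_natr cos2pi sin2pi oppr0.
have -> : - (t + 2 * pi * g%:R + 0) = - (t + 0) + g%:R * (- (2 * pi)) by ring.
by rewrite expiD expiMn e1 expr1n mulr1.
Qed.

End MatrixTrig.

(** * Normalization by elementary matrices *)

Section Normalization.
Variable R : realType.
Notation C := R[i].

Notation e1c s := (col_mx 1%:M 0 : 'cV[C]_(1 + s)).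
Notation e1r s := (row_mx 1%:M 0 : 'rV[C]_(1 + s)).

Lemma smooth_mx_block r1 r2 r3 r4 (A : R -> 'M[C]_(r1, r2)) (B : R -> 'M_(r1, r3))
    (D : R -> 'M_(r4, r2)) (E : R -> 'M_(r4, r3)) :
  smooth_mx (fun t => block_mx (A t) (B t) (D t) (E t)) <->
      [/\ smooth_mx A, smooth_mx B, smooth_mx D & smooth_mx E].
Proof.
split=> [h|[sA sB sD sE] i j].
  split=> i j.
  - have := h (lshift r4 i) (lshift r3 j); congr smooth0.
    by apply/funext => t; rewrite block_mxEul.
  - have := h (lshift r4 i) (rshift r2 j); congr smooth0.
    by apply/funext => t; rewrite block_mxEur.
  - have := h (rshift r1 i) (lshift r3 j); congr smooth0.
    by apply/funext => t; rewrite block_mxEdl.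
  - have := h (rshift r1 i) (rshift r2 j); congr smooth0.
    by apply/funext => t; rewrite block_mxEdr.
case: (split_ordP i) => i' ->; case: (split_ordP j) => j' ->.
- have := sA i' j'; congr smooth0.
  by apply/funext => t; rewrite block_mxEul.
- have := sB i' j'; congr smooth0.
  by apply/funext => t; rewrite block_mxEur.
- have := sD i' j'; congr smooth0.
  by apply/funext => t; rewrite block_mxEdl.
- have := sE i' j'; congr smooth0.
  by apply/funext => t; rewrite block_mxEdr.
Qed.

Lemma eqO_col r1 r2 r3 n (A A' : R -> 'M[C]_(r1, r3)) (B B' : R -> 'M[C]_(r2, r3)) :
  eqO n (fun t => col_mx (A t) (B t)) (fun t => col_mx (A' t) (B' t)) <->
  eqO n A A' /\ eqO n B B'.
Proof.
have eu (A0 : R -> 'M[C]_(r1, r3)) (B0 : R -> 'M[C]_(r2, r3)) i j :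
  (fun t => col_mx (A0 t) (B0 t) (lshift r2 i) j) = fun t => A0 t i j.
  by apply/funext => t; rewrite col_mxEu.
have ed (A0 : R -> 'M[C]_(r1, r3)) (B0 : R -> 'M[C]_(r2, r3)) i j :
  (fun t => col_mx (A0 t) (B0 t) (rshift r1 i) j) = fun t => B0 t i j.
  by apply/funext => t; rewrite col_mxEd.
split=> [/eqOP h|[/eqOP hA /eqOP hB]].
  split; apply/eqOP => i j.
    by have := h (lshift r2 i) j; rewrite !eu.
  by have := h (rshift r1 i) j; rewrite !ed.
apply/eqOP => i j; case: (split_ordP i) => i' ->; first by rewrite !eu.
by rewrite !ed.
Qed.

Lemma eqO_row r1 r2 r3 n (A A' : R -> 'M[C]_(r3, r1)) (B B' : R -> 'M[C]_(r3, r2)) :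
  eqO n (fun t => row_mx (A t) (B t)) (fun t => row_mx (A' t) (B' t)) <->
  eqO n A A' /\ eqO n B B'.
Proof.
have el (A0 : R -> 'M[C]_(r3, r1)) (B0 : R -> 'M[C]_(r3, r2)) i j :
  (fun t => row_mx (A0 t) (B0 t) i (lshift r2 j)) = fun t => A0 t i j.
  by apply/funext => t; rewrite row_mxEl.
have er (A0 : R -> 'M[C]_(r3, r1)) (B0 : R -> 'M[C]_(r3, r2)) i j :
  (fun t => row_mx (A0 t) (B0 t) i (rshift r1 j)) = fun t => B0 t i j.
  by apply/funext => t; rewrite row_mxEr.
split=> [/eqOP h|[/eqOP hA /eqOP hB]].
  split; apply/eqOP => i j.
    by have := h i (lshift r2 j); rewrite !el.
  by have := h i (rshift r1 j); rewrite !er.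
apply/eqOP => i j; case: (split_ordP j) => j' ->; first by rewrite !el.
by rewrite !er.
Qed.

Lemma smooth_mxN r1 r2 (F : R -> 'M[C]_(r1, r2)) : smooth_mx F ->
    smooth_mx (fun t => - F t).
Proof.
move=> sF i j; rewrite (_ : (fun t => _) = fun t => - F t i j).
  exact: smooth0N.
by apply/funext => t; rewrite mxE.
Qed.

Lemma inverse_mul r (U W U' W' : 'M[{poly C}]_r) :
  U *m W = 1%:M -> U' *m W' = 1%:M -> (U' *m U) *m (W *m W') = 1%:M.
Proof. by move=> h h'; rewrite mulmxA -(mulmxA U') h mulmx1. Qed.

Lemma upper_unitriangular_inverse s (Q : 'M[{poly C}]_(1, s)) :
  block_mx 1%:M Q 0 1%:M *m block_mx 1%:M (- Q) 0 1%:M = 1%:M :> 'M_(1 + s).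
Proof.
rewrite mulmx_block !mul1mx !mul0mx !mulmx0 !mulmx1 !addr0 addNr add0r.
by rewrite -scalar_mx_block.
Qed.

Lemma lower_unitriangular_inverse s (P : 'M[{poly C}]_(s, 1)) :
  block_mx 1%:M 0 P 1%:M *m block_mx 1%:M 0 (- P) 1%:M = 1%:M :> 'M_(1 + s).
Proof.
rewrite mulmx_block !mul1mx !mul0mx !mulmx0 !mulmx1 !addr0 subrr add0r.
by rewrite -scalar_mx_block.
Qed.

Lemma smooth_mx_usub r1 r2 r3 (F : R -> 'M[C]_(r1 + r2, r3)) : smooth_mx F ->
    smooth_mx (fun t => usubmx (F t)).
Proof.
move=> sF i j; have := sF (lshift r2 i) j; congr smooth0.
by apply/funext => t; rewrite mxE.
Qed.

Lemma smooth_mx_dsub r1 r2 r3 (F : R -> 'M[C]_(r1 + r2, r3)) : smooth_mx F ->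
    smooth_mx (fun t => dsubmx (F t)).
Proof.
move=> sF i j; have := sF (rshift r1 i) j; congr smooth0.
by apply/funext => t; rewrite mxE.
Qed.

Lemma smooth_mx_lsub r1 r2 r3 (F : R -> 'M[C]_(r3, r1 + r2)) : smooth_mx F ->
    smooth_mx (fun t => lsubmx (F t)).
Proof.
move=> sF i j; have := sF i (lshift r2 j); congr smooth0.
by apply/funext => t; rewrite mxE.
Qed.

Lemma smooth_mx_rsub r1 r2 r3 (F : R -> 'M[C]_(r3, r1 + r2)) : smooth_mx F ->
    smooth_mx (fun t => rsubmx (F t)).
Proof.
move=> sF i j; have := sF i (rshift r1 j); congr smooth0.
by apply/funext => t; rewrite mxE.
Qed.

(** If an entry w_i below the first one is a unit of the local ring of jets,
    adding (1 - u) / w_i times it to the first entry u makes that entry 1; the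
    1 then clears the column. Only elementary matrices are used, and their
    entries may be replaced by polynomials with the same jets, so the product
    is invertible over {poly C}. *)
Lemma reduce_tail N s (phi : R -> 'cV[C]_(1 + s)) : smooth_mx phi ->
    dsubmx (phi 0) != 0 ->
  exists U W : 'M[{poly C}]_(1 + s), U *m W = 1%:M /\
    eqO N (fun t => zevalmx U t *m phi t) (fun=> e1c s).
Proof.
move=> sphi; have su := smooth_mx_usub sphi; have sw := smooth_mx_dsub sphi.
set u := fun t => usubmx (phi t) in su; set w := fun t => dsubmx (phi t) in sw.
have phiE t : phi t = col_mx (u t) (w t) by rewrite vsubmxK.
case/matrix0Pn => i [j]; rewrite ord1 => wi {j}; rewrite -/(w 0) in wi.
have sq : smooth0 (fun t => (1 - u t 0 0) * (w t i 0)^-1).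
  apply: smooth0M; last exact: (smooth0V (sw i 0)).
  by apply: smooth0B; [exact: smooth0_const | exact: su].
have [p pE] := zeval_approx N sq.
have [P PE] := zevalmx_approx N sw.
(* Adding Q w to u has the effect of adding p w_i, and u + p w_i = 1 + O(|xi|^N). *)
pose Q : 'M[{poly C}]_(1, s) := p *: delta_mx 0 i.
have Q_mul t : zevalmx Q t *m w t = (zeval 0 p t * w t i 0)%:M.
  apply/matrixP => a b; rewrite !ord1 !mxE (bigD1 i) //= big1 ?addr0.
    by rewrite zevalmxE !mxE !eqxx mulr1 mulr1n.
  by move=> k ki; rewrite zevalmxE !mxE (negbTE ki) andbF mulr0 /zeval horner0 mul0r.
have uQ : eqO N (fun t => u t + zevalmx Q t *m w t) (fun=> 1%:M).
  apply/eqOP => a b; rewrite !ord1.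
  have -> : (fun t => (u t + zevalmx Q t *m w t) 0 0) = fun t => u t 0 0 +
      zeval 0 p t * w t i 0.
    by apply/funext => t; rewrite Q_mul !mxE eqxx mulr1n.
  have [V [oV V0 Vw _]] := smooth0_nonzero (sw i 0) wi.
  apply: (@eqjet_trans _ _ (fun t => u t 0 0 +
      ((1 - u t 0 0) * (w t i 0)^-1) * w t i 0)).
    apply: eqjetD => //; do ?[exact: su].
    - by apply: smooth0M; [exact: smooth0_zeval | exact: sw].
    - by apply: smooth0M => //; exact: sw.
    - by apply: eqjetM => //; exact: smooth0_zeval.
  apply: (@eqjet_ext _ V) => // t; rewrite inE => Vt.
  by rewrite mulfVK ?Vw // addrC subrK mxE eqxx.
exists (block_mx 1%:M 0 (- P) 1%:M *m block_mx 1%:M Q 0 1%:M),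
       (block_mx 1%:M (- Q) 0 1%:M *m block_mx 1%:M 0 P 1%:M); split.
  apply: inverse_mul; first exact: upper_unitriangular_inverse.
  by have := lower_unitriangular_inverse (- P); rewrite opprK.
have s1 : smooth_mx (fun t => u t + zevalmx Q t *m w t).
  by apply: smooth_mxD => //; apply: smooth_mxM => //; exact: smooth_mx_zevalmx.
have sc := @smooth_mx_const R.
have -> : (fun t => zevalmx
    (block_mx 1%:M 0 (- P) 1%:M *m block_mx 1%:M Q 0 1%:M) t *m phi t) =
   fun t => col_mx (u t + zevalmx Q t *m w t)
       (w t + (- zevalmx P t) *m (u t + zevalmx Q t *m w t)).
  apply/funext => t; rewrite zevalmxM !zevalmx_block !zevalmx1 !zevalmx0 phiE -mulmxA.
  rewrite !mul_block_col !mul1mx !mul0mx !addr0 !add0r [zevalmx (- P) t]map_mxN.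
  by rewrite [_ *m _ + w t]addrC.
apply/eqO_col; split => //.
apply: (@eqO_trans _ _ _ _ (fun t => w t + (- zevalmx P t) *m 1%:M)).
  have sNP : smooth_mx (fun t => - zevalmx P t).
    by apply: smooth_mxN; exact: smooth_mx_zevalmx.
  by apply: eqOD => //; [exact: smooth_mxM | exact: smooth_mxM | exact: eqOMl].
apply: (@eqO_trans _ _ _ _ (fun t => zevalmx P t + (- zevalmx P t) *m 1%:M)).
  have sNP : smooth_mx (fun t => (- zevalmx P t) *m (1%:M : 'M_1)).
    by apply: smooth_mxM => //; apply: smooth_mxN; exact: smooth_mx_zevalmx.
  by apply: eqOD => //; [exact: smooth_mx_zevalmx | exact: eqO_sym].
by apply: eqO_ext => t; rewrite mulmx1 subrr.
Qed.

(** A column that does not vanish at 0 is unimodular over the local ring of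
    jets. When its tail does vanish at 0, its first entry is first added to
    the tail; this is where a second entry is needed. *)
Lemma reduce_to_e1 N s (phi : R -> 'cV[C]_(1 + s)) : (0 < s)%N -> smooth_mx phi ->
    phi 0 != 0 ->
  exists U W : 'M[{poly C}]_(1 + s), U *m W = 1%:M /\
    eqO N (fun t => zevalmx U t *m phi t) (fun=> e1c s).
Proof.
move=> s0 sphi phi0; have [w0|] := eqVneq (dsubmx (phi 0)) 0; last exact: reduce_tail.
(* Adding the first entry to all the others makes the tail nonzero at 0. *)
pose P : 'M[{poly C}]_(s, 1) := map_mx polyC (const_mx 1).
pose E : 'M[{poly C}]_(1 + s) := block_mx 1%:M 0 P 1%:M.
have EE t : zevalmx E t *m phi t =
    col_mx (usubmx (phi t)) (const_mx 1 *m usubmx (phi t) + dsubmx (phi t)).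
  rewrite /E zevalmx_block !zevalmx1 zevalmx0 zevalmx_const -{1}[phi t]vsubmxK mul_block_col.
  by rewrite !mul1mx mul0mx addr0.
have [||U [W [UW Ue]]] := @reduce_tail N s (fun t => zevalmx E t *m phi t).
- by apply: smooth_mxM => //; exact: smooth_mx_zevalmx.
- rewrite EE col_mxKd w0 addr0; apply: contra phi0 => /eqP h.
  rewrite -[phi 0]vsubmxK w0; suff -> : usubmx (phi 0) = 0 by rewrite col_mx0.
  apply/matrixP => a b; rewrite !ord1.
  move/matrixP: h => /(_ (Ordinal s0) 0); rewrite !mxE big_ord1 !mxE mul1r.
  by [].
exists (U *m E), (block_mx 1%:M 0 (- P) 1%:M *m W); split.
  by apply: inverse_mul => //; exact: lower_unitriangular_inverse.
by apply: eqO_trans Ue; apply: eqO_ext => t; rewrite zevalmxM mulmxA.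
Qed.

(** After phi has been reduced to e_1, the row v becomes (1 + O(|xi|^m), w),
    because its pairing with phi is preserved. The shear with first row (1, w)
    fixes e_1 and clears w. *)
Lemma exists_normalization m n s (v : R -> 'rV[C]_(1 + s))
    (phi : R -> 'cV[C]_(1 + s)) :
  (0 < s)%N -> smooth_mx v -> smooth_mx phi -> phi 0 != 0 ->
  eqO m (fun t => v t *m phi t) (fun=> 1%:M) ->
  exists U W : 'M[{poly C}]_(1 + s), [/\ U *m W = 1%:M,
    eqO n (fun t => zevalmx U t *m phi t) (fun=> e1c s) &
    eqO m (fun t => v t *m zevalmx W t) (fun=> e1r s)].
Proof.
move=> s0 sv sphi phi0 vphi.
have [U [W [UW Ue]]] := reduce_to_e1 (maxn m n) s0 sphi phi0.
have UWt t : zevalmx W t *m zevalmx U t = 1%:M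
    by rewrite -zevalmxM (mulmx1C UW) zevalmx1.
have sU := @smooth_mx_zevalmx _ _ _ U; have sW := @smooth_mx_zevalmx _ _ _ W.
have sV : smooth_mx (fun t => v t *m zevalmx W t) by exact: smooth_mxM.
have sc := @smooth_mx_const R.
have [Q QE] := zevalmx_approx m (smooth_mx_rsub sV).
have Vl : eqO m (fun t => lsubmx (v t *m zevalmx W t)) (fun=> 1%:M).
  have -> : (fun t => lsubmx (v t *m zevalmx W t)) =
      fun t => (v t *m zevalmx W t) *m e1c s.
    apply/funext => t; rewrite -[in RHS](hsubmxK (v t *m zevalmx W t)) mul_row_col.
    by rewrite mulmx1 mulmx0 addr0.
  apply: eqO_trans vphi; apply:
      (@eqO_trans _ _ _ _ (fun t => (v t *m zevalmx W t) *m (zevalmx U t *m phi t))).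
    apply: eqOMl => //; first exact: smooth_mxM.
    exact/eqO_sym/(eqO_le (leq_maxl m n) Ue).
  by apply: eqO_ext => t; rewrite mulmxA -(mulmxA (v t)) UWt mulmx1.
exists (block_mx 1%:M Q 0 1%:M *m U), (W *m block_mx 1%:M (- Q) 0 1%:M); split.
- by apply: inverse_mul => //; exact: upper_unitriangular_inverse.
- apply: (@eqO_trans _ _ _ _ (fun t => zevalmx (block_mx 1%:M Q 0 1%:M) t *m e1c s));
    last first.
    apply: eqO_ext => t; rewrite zevalmx_block !zevalmx1 zevalmx0 mul_block_col.
    by rewrite !mulmx0 mul0mx !mulmx1 !addr0.
  apply: (@eqO_trans _ _ _ _ (fun t => zevalmx (block_mx 1%:M Q 0 1%:M) t *m
      (zevalmx U t *m phi t))).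
    by apply: eqO_ext => t; rewrite zevalmxM mulmxA.
  apply: eqOMl => //; [exact: smooth_mx_zevalmx | exact: smooth_mxM |].
  exact: (eqO_le (leq_maxr m n) Ue).
have -> : (fun t => v t *m zevalmx (W *m block_mx 1%:M (- Q) 0 1%:M) t) =
   fun t => row_mx (lsubmx (v t *m zevalmx W t))
     (lsubmx (v t *m zevalmx W t) *m (- zevalmx Q t) + rsubmx (v t *m zevalmx W t)).
  apply/funext => t; rewrite zevalmxM mulmxA -[in LHS](hsubmxK (v t *m zevalmx W t)).
  rewrite zevalmx_block !zevalmx1 zevalmx0 mul_row_block !mulmx1 mulmx0 addr0.
  by rewrite [zevalmx (- Q) t]map_mxN.
apply/eqO_row; split => //.
have sNQ : smooth_mx (fun t => - zevalmx Q t).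
  by apply: smooth_mxN; exact: smooth_mx_zevalmx.
have sl := smooth_mx_lsub sV; have sr := smooth_mx_rsub sV.
apply: (@eqO_trans _ _ _ _ (fun t => 1%:M *m (- zevalmx Q t) + zevalmx Q t)).
  apply: eqOD => //; do ?[exact: smooth_mxM]; do ?[exact: smooth_mx_zevalmx].
    exact: eqOMr.
  exact: eqO_sym.
by apply: eqO_ext => t; rewrite mul1mx addNr.
Qed.

End Normalization.

(** * Gram-Schmidt over polynomials in z *)

Section GramSchmidt.
Variable R : realType.
Notation C := R[i].

Lemma adjM r1 r2 r3 (A : 'M[C]_(r1, r2)) (B : 'M_(r2, r3)) :
  (A *m B)^t* = B^t* *m A^t*.
Proof. by rewrite trmx_mul map_mxM. Qed.

Lemma adjK r1 r2 (A : 'M[C]_(r1, r2)) : (A^t*)^t* = A.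
Proof. by apply/matrixP => i j; rewrite !mxE conjCK. Qed.

Lemma adj1 r : (1%:M : 'M[C]_r)^t* = 1%:M.
Proof. by rewrite trmx1 map_mx1. Qed.

Lemma adj0 r1 r2 : (0 : 'M[C]_(r1, r2))^t* = 0.
Proof. by rewrite trmx0 map_mx0. Qed.

Lemma adj_block r1 r2 r3 r4 (A : 'M[C]_(r1, r2)) (B : 'M_(r1, r3))
    (D : 'M_(r4, r2)) (E : 'M_(r4, r3)) :
  (block_mx A B D E)^t* = block_mx (A^t*) (D^t*) (B^t*) (E^t*).
Proof. by rewrite tr_block_mx map_block_mx. Qed.

Lemma adj_col r1 r2 r3 (A : 'M[C]_(r1, r3)) (B : 'M_(r2, r3)) :
  (col_mx A B)^t* = row_mx (A^t*) (B^t*).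
Proof. by rewrite tr_col_mx map_row_mx. Qed.

Lemma smooth_mx_submx r1 r2 r3 r4 (F : R -> 'M[C]_(r1 + r4, r2 + r3)) : smooth_mx F ->
  [/\ smooth_mx (fun t => ulsubmx (F t)), smooth_mx (fun t => ursubmx (F t)),
      smooth_mx (fun t => dlsubmx (F t)) & smooth_mx (fun t => drsubmx (F t))].
Proof.
move=> sF; apply/smooth_mx_block.
by apply: smooth_mx_ext sF => t; rewrite submxK.
Qed.

(** Diagonalization of a positive Hermitian form modulo O(|xi|^N) by a
    polynomial matrix: the first column is kept, polynomials with the jets of
    - b / g make the others orthogonal to it, and the lower right block of the
    new Gram matrix is handled by induction. It is exactly Hermitian and
    exactly positive at 0 since it is a block of T1^* G T1; only the
    off-diagonal blocks are approximate. *)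
Lemma gram_schmidt N s (G : R -> 'M[C]_(1 + s)) : smooth_mx G ->
  (forall t, (G t)^t* = G t) ->
  (forall x : 'cV_(1 + s), x != 0 -> 0 < (x^t* *m G 0 *m x) 0 0) ->
  exists T S : 'M[{poly C}]_(1 + s), [/\ T *m S = 1%:M,
    T *m col_mx 1%:M 0 = col_mx 1%:M 0 &
    forall i j, i != j ->
      eqjet N (fun t => ((zevalmx T t)^t* *m G t *m zevalmx T t) i j) (fun=> 0)].
Proof.
elim: s G => [|s IH] G sG hG pG.
  exists 1%:M, 1%:M; split; rewrite ?mulmx1 ?mul1mx //.
  by move=> i j; rewrite !ord1.
have [sg sb _ sd] := smooth_mx_submx sG.
set g := fun t => ulsubmx (G t) in sg; set b := fun t => ursubmx (G t) in sb.
have g0 : g 0 0 0 != 0.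
  have := pG (col_mx 1%:M 0); rewrite -[G 0]submxK adj_col mul_row_block.
  rewrite mul_row_col adj1 adj0 !mul0mx !mul1mx !addr0 mulmx1 mulmx0 addr0.
  move=> h; apply: lt0r_neq0; apply: h.
  apply/eqP => /matrixP/(_ (lshift _ 0) 0)/eqP.
  by rewrite col_mxEu !mxE eqxx oner_eq0.
have [Q QE] := zevalmx_approx N (smooth_mxZ (smooth0N (smooth0V (sg 0 0) g0)) sb).
pose T1 : 'M[{poly C}]_(1 + (1 + s)) := block_mx 1%:M Q 0 1%:M.
pose H t := (zevalmx T1 t)^t* *m G t *m zevalmx T1 t.
have sT1 := @smooth_mx_zevalmx _ _ _ T1.
have sH : smooth_mx H by apply: smooth_mxM => //; apply: smooth_mxM => //;
    exact: smooth_mx_adj.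
have [sHul sHur sHdl sHdr] := smooth_mx_submx sH.
have hH t : (H t)^t* = H t by rewrite /H !adjM adjK hG mulmxA.
have hHdr t : (drsubmx (H t))^t* = drsubmx (H t).
  by have := congr1 drsubmx (hH t); rewrite -{1}[H t]submxK adj_block block_mxKdr.
have hHdl t : dlsubmx (H t) = (ursubmx (H t))^t*.
  by have := congr1 dlsubmx (hH t); rewrite -{1}[H t]submxK adj_block block_mxKdl.
(* The upper right block of H is g Q + b, and Q has the jet of - b / g. *)
have Hur : eqO N (fun t => ursubmx (H t)) (fun=> 0).
  have -> : (fun t => ursubmx (H t)) = fun t => g t *m zevalmx Q t + b t.
    apply/funext => t; rewrite /H -[G t]submxK /T1 zevalmx_block !zevalmx1 zevalmx0.
    rewrite adj_block adj0 !adj1 !mulmx_block block_mxKur.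
    by rewrite !mul1mx !mul0mx !mulmx1 !addr0.
  have [V [oV V0 Vg _]] := smooth0_nonzero (sg 0 0) g0.
  have sQ := @smooth_mx_zevalmx _ _ _ Q.
  have sgi : smooth_mx (fun t => - (g t 0 0)^-1 *: b t).
    by apply: smooth_mxZ => //; apply/smooth0N/smooth0V.
  apply: (@eqO_trans _ _ _ _ (fun t => g t *m (- (g t 0 0)^-1 *: b t) + b t)).
    by apply: eqOD => //; [exact: smooth_mxM | exact: smooth_mxM | exact: eqOMl].
  apply/eqOP => i j; apply: (@eqjet_ext _ V) => // t; rewrite inE => Vt.
  rewrite !mxE big_ord1 !mxE ord1 mulrA mulrN mulfV ?mulN1r ?addNr //.
  by have := Vg t Vt; rewrite /g !mxE.
have pHdr (x : 'cV_(1 + s)) : x != 0 -> 0 < (x^t* *m drsubmx (H 0) *m x) 0 0.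
  move=> x0; have -> : x^t* *m drsubmx (H 0) *m x =
      (zevalmx T1 0 *m col_mx 0 x)^t* *m G 0 *m (zevalmx T1 0 *m col_mx 0 x).
    rewrite adjM [RHS](_ : _ = (col_mx 0 x)^t* *m H 0 *m col_mx 0 x); last
        by rewrite /H !mulmxA.
    rewrite -[in RHS](submxK (H 0)) adj_col adj0 mul_row_block mul_row_col.
    by rewrite !mul0mx !mulmx0 !add0r.
  apply: pG; apply: contra x0 => /eqP y0.
  have : zevalmx (block_mx 1%:M (- Q) 0 1%:M) 0 *m (zevalmx T1 0 *m col_mx 0 x) = 0.
    by rewrite y0 mulmx0.
  rewrite mulmxA -zevalmxM (mulmx1C
      (upper_unitriangular_inverse Q)) zevalmx1 mul1mx => /eqP.
  by rewrite col_mx_eq0 => /andP[].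
have [T' [S' [TS Te off]]] := IH _ sHdr hHdr pHdr.
pose B : 'M[{poly C}]_(1 + (1 + s)) := block_mx 1%:M 0 0 T'.
exists (T1 *m B), (block_mx 1%:M 0 0 S' *m block_mx 1%:M (- Q) 0 1%:M); split.
- apply: inverse_mul; last exact: upper_unitriangular_inverse.
  rewrite mulmx_block !mulmx0 !mul0mx !mul1mx TS !addr0 !add0r.
  by rewrite -scalar_mx_block.
- rewrite -mulmxA /T1 /B mul_block_col !mulmx0 !mul0mx !mul1mx !addr0 mul_block_col.
  by rewrite !mulmx0 !mul0mx mulmx1 !addr0.
have sT' := @smooth_mx_zevalmx _ _ _ T'.
have HE : (fun t => (zevalmx (T1 *m B) t)^t* *m G t *m zevalmx (T1 *m B) t) =
    fun t => block_mx (ulsubmx (H t)) (ursubmx (H t) *m zevalmx T' t)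
      ((zevalmx T' t)^t* *m dlsubmx (H t))
      ((zevalmx T' t)^t* *m drsubmx (H t) *m zevalmx T' t).
  apply/funext => t; rewrite zevalmxM adjM.
  have -> : (zevalmx B t)^t* *m (zevalmx T1 t)^t* *m G t *m
      (zevalmx T1 t *m zevalmx B t)
    = (zevalmx B t)^t* *m H t *m zevalmx B t by rewrite /H !mulmxA.
  rewrite -{1}[H t]submxK /B zevalmx_block zevalmx1 !zevalmx0 adj_block !adj0 adj1.
  by rewrite !mulmx_block !mulmx0 !mul0mx !mul1mx !mulmx1 !addr0 !add0r ?mul0mx ?addr0.
move=> i j; rewrite (_ : (fun t => _) = fun t =>
    (block_mx (ulsubmx (H t)) (ursubmx (H t) *m zevalmx T' t)
      ((zevalmx T' t)^t* *m dlsubmx (H t))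
      ((zevalmx T' t)^t* *m drsubmx (H t) *m zevalmx T' t)) i j); last first.
  by apply/funext => t; rewrite (congr1 (fun F => F t) HE).
have ur0 : eqO N (fun t => ursubmx (H t) *m zevalmx T' t) (fun=> 0).
  apply: (@eqO_trans _ _ _ _ (fun t => 0 *m zevalmx T' t)); last first.
    by apply: eqO_ext => t; rewrite mul0mx.
  by apply: eqOMr => //; exact: smooth_mx_const.
have dl0 : eqO N (fun t => (zevalmx T' t)^t* *m dlsubmx (H t)) (fun=> 0).
  have -> : (fun t => (zevalmx T' t)^t* *m dlsubmx (H t)) =
      fun t => (ursubmx (H t) *m zevalmx T' t)^t*.
    by apply/funext => t; rewrite adjM hHdl.
  apply: (@eqO_trans _ _ _ _ (fun=> 0^t*)); last by apply: eqO_ext => t; rewrite adj0.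
  by apply: eqO_adj => //; [exact: smooth_mxM | exact: smooth_mx_const].
have at0 r1 r2 (F : R -> 'M[C]_(r1, r2)) k l : eqO N F (fun=> 0) ->
    eqjet N (fun t => F t k l) (fun=> 0).
  by move/eqOP/(_ k l); rewrite (_ : (fun t => (0 : 'M_(r1, r2)) k l) = fun=> 0) //;
     apply/funext => t; rewrite mxE.
case: (split_ordP i) => i' ->; case: (split_ordP j) => j' -> ij.
- by move: ij; rewrite !ord1 eqxx.
- by have := at0 _ _ _ i' j' ur0; congr eqjet; apply/funext => t; rewrite block_mxEur.
- by have := at0 _ _ _ i' j' dl0; congr eqjet; apply/funext => t; rewrite block_mxEdl.
- have ij' : i' != j' by apply: contra ij => /eqP ->.
  by have := off i' j' ij'; congr eqjet; apply/funext => t; rewrite block_mxEdr.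
Qed.

End GramSchmidt.

(** * From a normalization to the normal form *)

Section FilterFactors.
Variable R : realType.
Notation C := R[i].

Lemma omega_uniq d (I : seq nat) : (0 < d)%N -> uniq I ->
    (forall k, k \in I -> (k < d)%N) ->
  uniq [seq omega R d ^+ k | k <- I].
Proof.
move=> d0 uI Id; rewrite map_inj_in_uniq // => i j iI jI /eqP.
by rewrite (eq_prim_root_expr (omega_primitive R d0)) !modn_small ?Id // => /eqP.
Qed.

(** Vanishing to order m at the points 2 pi g / d, 1 <= g < d, is what the sum
    rules say about the entry (1,1). *)
Lemma trig_factor_sum m d (f : R -> C) : (0 < d)%N -> trig f ->
  (forall g : nat, (1 <= g <= d.-1)%N ->
     eqjet m (fun t => f (t + 2 * pi * g%:R / d%:R)) (fun=> 0)) ->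
  exists2 g, trig g & forall t, f t = (\sum_(k < d) expi (- (k%:R * t))) ^+ m * g t.
Proof.
move=> d0 tf h.
have [|w|g tg fE] := @trig_vanish _ m f [seq omega R d ^+ k | k <- iota 1 d.-1] tf.
- apply: omega_uniq => //; first exact: iota_uniq.
  by move=> k; rewrite mem_iota add1n prednK // => /andP[].
- case/mapP => k; rewrite mem_iota add1n ltnS => kd ->.
  by exists (2 * pi * k%:R / d%:R); [exact: omega_exp | exact: h].
exists g => // t; rewrite fE prod_omega_sum // horner_sum; congr (_ ^+ m * _).
by apply: eq_bigr => k _; rewrite hornerXn -expiMn mulrN.
Qed.

(** Vanishing also at 0 adds the missing factor 1 - z; this is the situation
    of the other entries of the first row. *)
Lemma trig_factor_full m d (f : R -> C) : (0 < d)%N -> trig f ->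
  (forall g : nat, (g < d)%N ->
     eqjet m (fun t => f (t + 2 * pi * g%:R / d%:R)) (fun=> 0)) ->
  exists2 g, trig g & forall t, f t = (1 - expi (- (d%:R * t))) ^+ m * g t.
Proof.
move=> d0 tf h.
have [|w|g tg fE] := @trig_vanish _ m f [seq omega R d ^+ k | k <- iota 0 d] tf.
- apply: omega_uniq => //; first exact: iota_uniq.
  by move=> k; rewrite mem_iota add0n => /andP[].
- case/mapP => k; rewrite mem_iota add0n => /andP[_ kd] ->.
  by exists (2 * pi * k%:R / d%:R); [exact: omega_exp | exact: h].
exists (fun t => (-1) ^+ m * g t); first by apply: trigM => //; exact: trig_const.
move=> t; rewrite fE mulrA -exprMn mulrN1 opprB horner_prod; congr (_ ^+ m * _).
under eq_bigr do rewrite hornerXsubC.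
by rewrite prod_omega // -expiMn mulrN.
Qed.

Lemma trig_factor_one n (f : R -> C) : trig f -> eqjet n f (fun=> 0) ->
  exists2 g, trig g & forall t, f t = (1 - expi (- t)) ^+ n * g t.
Proof.
move=> tf h; have [|w|g tg fE] := @trig_vanish _ n f [:: 1] tf.
- by [].
- rewrite inE => /eqP ->; exists 0; first by rewrite oppr0 expi0.
  by rewrite (_ : (fun t => _) = f) //; apply/funext => t; rewrite addr0.
exists (fun t => (-1) ^+ n * g t); first by apply: trigM => //; exact: trig_const.
by move=> t; rewrite fE mulrA -exprMn mulrN1 opprB big_seq1 hornerXsubC.
Qed.

Lemma trig_mx_fourier r1 r2 (u : l0 R r1 r2) : trig_mx (fourier u).
Proof. by move=> i j; apply: trig_fourier. Qed.

Lemma trig_mx_factor r1 r2 (F : R -> 'M[C]_(r1, r2)) (c : R -> C) :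
  (forall i j, exists2 g, trig g & forall t, F t i j = c t * g t) ->
  exists P : l0 R r1 r2, forall t, F t = c t *: fourier P t.
Proof.
move=> h; have /choice[g gE] : forall ij : 'I_r1 * 'I_r2,
    exists g, trig g /\ forall t, F t ij.1 ij.2 = c t * g t.
  by move=> [i j]; have [g tg gE] := h i j; exists g.
have [|P PE] := @trig_is_fourier _ r1 r2 (fun t => \matrix_(i, j) g (i, j) t).
  move=> i j; apply: trig_ext (gE (i, j)).1 => t; by rewrite mxE.
exists P => t; rewrite -PE; apply/matrixP => i j.
by rewrite !mxE (gE (i, j)).2.
Qed.

Lemma invmx_eq r (A B : 'M[C]_r) : A *m B = 1%:M -> invmx A = B.
Proof.
by move=> AB; have [uA _] := mulmx1_unit AB; rewrite -[LHS]mulmx1 -AB mulKmx.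
Qed.

(** With v U^{-1} = e_1^T + O(|xi|^m) the sum rules become statements about
    the first row of the new mask: it equals e_1^T to order m at 0 and
    vanishes to order m at 2 pi g / d. With U phi = e_1 + O(|xi|^n) the
    refinement equation says that the first column is e_1 to order n at 0. The
    factors are then read off from these zeros. *)
Lemma normal_form_of_normalization d m n s (a : l0 R (1 + s) (1 + s))
    (v : l0 R 1 (1 + s))
    (phi : R -> 'cV[C]_(1 + s)) (U W : 'M[{poly C}]_(1 + s))
        (u : l0 R (1 + s) (1 + s)) :
  (2 <= d)%N -> smooth_mx phi -> U *m W = 1%:M ->
      (forall t, fourier u t = zevalmx U t) ->
  (forall t, phi (d%:R * t) = fourier a t *m phi t) -> sum_rules d m a v ->
  eqO n (fun t => zevalmx U t *m phi t) (fun=> col_mx 1%:M 0) ->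
  eqO m (fun t => fourier v t *m zevalmx W t) (fun=> row_mx 1%:M 0) ->
  normal_form d m n a v phi u.
Proof.
move=> d2 sphi UW uE ref [v0 sr0 srg] Uphi vW.
have d0 : (0 < d)%N by apply: leq_trans d2.
have UWt t : zevalmx U t *m zevalmx W t = 1%:M by rewrite -zevalmxM UW zevalmx1.
have WUt t : zevalmx W t *m zevalmx U t = 1%:M
    by rewrite -zevalmxM (mulmx1C UW) zevalmx1.
have invu t : invmx (fourier u t) = zevalmx W t by rewrite uE; apply: invmx_eq.
have [a' aE] : is_fourier (fun t => zevalmx U (d%:R * t) *m fourier a t *m
    zevalmx W t).
  apply: trig_is_fourier; apply: trig_mxM; last exact: trig_mx_zevalmx.
  apply: trig_mxM; last exact: trig_mx_fourier.
  exact: (trig_mx_dilate d (@trig_mx_zevalmx _ _ _ U)).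
have [v' vE] : is_fourier (fun t => fourier v t *m zevalmx W t).
  by apply: trig_is_fourier; apply: trig_mxM;
      [exact: trig_mx_fourier | exact: trig_mx_zevalmx].
have sU := @smooth_mx_zevalmx _ _ _ U; have sW := @smooth_mx_zevalmx _ _ _ W.
have sa := smooth_mx_fourier a; have sv := smooth_mx_fourier v.
have sa' := smooth_mx_fourier a'; have sv' := smooth_mx_fourier v'.
have sc := @smooth_mx_const R.
have vd : eqO m (fun t => fourier v' (d%:R * t)) (fun=> row_mx 1%:M 0).
  have := @eqO_dilate _ _ _ m d%:R (fourier v') (fun=> row_mx 1%:M 0) sv' (sc _ _ _).
  by apply; apply: eqO_trans vW; apply: eqO_ext => t; rewrite vE.
have v'e : eqO m (fourier v') (fun=> row_mx 1%:M 0).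
  by apply: eqO_trans vW; apply: eqO_ext => t; rewrite vE.
have svd : smooth_mx (fun t => fourier v (d%:R * t))
    by exact: (smooth_mx_dilate d%:R sv).
have svd' : smooth_mx (fun t => fourier v' (d%:R * t))
    by exact: (smooth_mx_dilate d%:R sv').
have sr0' : eqO m (fun t => fourier v' (d%:R * t) *m fourier a' t) (fourier v').
  apply: (@eqO_trans _ _ _ _ (fun t => (fourier v (d%:R * t) *m fourier a t) *m
      zevalmx W t)).
    apply: eqO_ext => t; rewrite -vE -aE !mulmxA -(mulmxA (fourier v _)) WUt mulmx1.
    by [].
  apply: (@eqO_trans _ _ _ _ (fun t => fourier v t *m zevalmx W t)).
    by apply: eqOMr => //; exact: smooth_mxM.
  by apply: eqO_ext => t; rewrite vE.
have srg' (g : nat) : (1 <= g <= d.-1)%N ->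
    eqO m (fun t => fourier v' (d%:R * t) *m fourier a' (t + 2 * pi * g%:R / d%:R))
        (fun=> 0).
  move=> gd; have sas := smooth_mx_fourier_shift a (2 * pi * g%:R / d%:R).
  have sWs : smooth_mx (fun t => zevalmx W (t + 2 * pi * g%:R / d%:R)).
    have [w wE] := zevalmx_is_fourier W.
    by apply: smooth_mx_ext (smooth_mx_fourier_shift w (2 * pi * g%:R / d%:R)) => t;
        rewrite wE.
  apply: (@eqO_trans _ _ _ _ (fun t => (fourier v (d%:R * t) *m
      fourier a (t + 2 * pi * g%:R / d%:R)) *m zevalmx W (t + 2 * pi * g%:R / d%:R))).
    apply: eqO_ext => t; rewrite -vE -aE.
    (* U (d xi) is unchanged by the shift of xi by 2 pi g / d. *)
    have -> : d%:R * (t + 2 * pi * g%:R / d%:R) = d%:R * t + 2 * pi * g%:R.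
      by rewrite mulrDr mulrC [d%:R * (_ / _)]mulrC divfK // pnatr_eq0 -lt0n.
    by rewrite zevalmx_periodic !mulmxA -(mulmxA (fourier v _)) WUt mulmx1.
  apply: (@eqO_trans _ _ _ _ (fun t => 0 *m zevalmx W (t + 2 * pi * g%:R / d%:R))).
    by apply: eqOMr => //; [exact: smooth_mxM | exact: srg].
  by apply: eqO_ext => t; rewrite mul0mx.
have sumr : sum_rules d m a' v'.
  split => //; rewrite -vE; apply: contra v0 => /eqP h.
  by rewrite -[fourier v 0]mulmx1 -(WUt 0) mulmxA h mul0mx.
have ref' t : (zevalmx U (d%:R * t) *m phi (d%:R * t)) = fourier a' t *m
    (zevalmx U t *m phi t).
  by rewrite -aE ref !mulmxA -(mulmxA _ (zevalmx W t)) WUt mulmx1.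
have row0 : eqO m (fun t => row_mx 1%:M 0 *m fourier a' t) (fun=> row_mx 1%:M 0).
  apply: eqO_trans v'e; apply: eqO_trans sr0'.
  by apply: eqO_sym; apply: eqOMr.
have rowg (g : nat) : (1 <= g <= d.-1)%N ->
    eqO m (fun t => row_mx 1%:M 0 *m fourier a' (t + 2 * pi * g%:R / d%:R)) (fun=> 0).
  move=> gd; apply: eqO_trans (srg' g gd); apply: eqO_sym; apply: eqOMr => //.
  exact: smooth_mx_fourier_shift.
have col0 : eqO n (fun t => fourier a' t *m col_mx 1%:M 0) (fun=> col_mx 1%:M 0).
  have sUphi : smooth_mx (fun t => zevalmx U t *m phi t) by exact: smooth_mxM.
  have Ud := @eqO_dilate _ _ _ n d%:R _ _ sUphi (sc _ _ _) Uphi.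
  apply: eqO_trans Ud; apply:
      (@eqO_trans _ _ _ _ (fun t => fourier a' t *m (zevalmx U t *m phi t))).
    by apply: eqOMl => //; exact: eqO_sym.
  by apply: eqO_ext => t; rewrite ref'.
have rowE t j : (row_mx 1%:M 0 *m fourier a' t) 0 j = fourier a' t (lshift s 0) j.
  rewrite -[fourier a' t in LHS](vsubmxK
      (fourier a' t)) mul_row_col mul1mx mul0mx addr0.
  by rewrite mxE.
have colE t i : (fourier a' t *m col_mx 1%:M 0) i 0 = fourier a' t i (lshift s 0).
  rewrite -[fourier a' t in LHS](hsubmxK
      (fourier a' t)) mul_row_col mulmx1 mulmx0 addr0.
  by rewrite mxE.
have ta i j : trig (fun t => fourier a' t i j) by exact: trig_fourier.
have van (g : nat) j : (1 <= g <= d.-1)%N ->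
    eqjet m (fun t => fourier a' (t + 2 * pi * g%:R / d%:R) (lshift s 0) j) (fun=> 0).
  move=> gd; have /eqOP/(_ 0 j) := rowg g gd.
  by congr eqjet; apply/funext => t; rewrite ?rowE ?mxE.
have van0 j : eqjet m (fun t => fourier a' t (lshift s 0) (rshift 1 j)) (fun=> 0).
  have /eqOP/(_ 0 (rshift 1 j)) := row0.
  by congr eqjet; apply/funext => t; rewrite ?rowE ?row_mxEr ?mxE.
have [P11 P11E] : exists P : l0 R 1 1, forall t, ulsubmx (fourier a' t) =
    (\sum_(k < d) expi (- (k%:R * t))) ^+ m *: fourier P t.
  apply: trig_mx_factor => i j; rewrite !ord1.
  have [g tg gE] := trig_factor_sum d0 (ta (lshift s 0) (lshift s 0))
      (fun g => van g _).
  by exists g => // t; rewrite !mxE -gE.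
have [P12 P12E] : exists P : l0 R 1 s, forall t, ursubmx (fourier a' t) =
    (1 - expi (- (d%:R * t))) ^+ m *: fourier P t.
  apply: trig_mx_factor => i j; rewrite !ord1.
  have [[|g] gd|g tg gE] := @trig_factor_full m d _ d0 (ta (lshift s 0) (rshift 1 j)).
  - have := van0 j; congr eqjet; apply/funext => t.
    by rewrite mulr0 mul0r addr0.
  - by apply: van; rewrite /= -ltnS prednK.
  - by exists g => // t; rewrite !mxE -gE.
have [P21 P21E] : exists P : l0 R s 1, forall t, dlsubmx (fourier a' t) =
    (1 - expi (- t)) ^+ n *: fourier P t.
  apply: trig_mx_factor => i j; rewrite !ord1.
  have [|g tg gE] := @trig_factor_one n _ (ta (rshift 1 i) (lshift s 0)).
    have /eqOP/(_ (rshift 1 i) 0) := col0.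
    by congr eqjet; apply/funext => t; rewrite ?colE ?col_mxEd ?mxE.
  by exists g => // t; rewrite !mxE -gE.
have [P22 P22E] : exists P : l0 R s s, forall t, drsubmx (fourier a' t) = fourier P t.
  have [|P PE] := @trig_is_fourier _ s s (fun t => drsubmx (fourier a' t)).
    by move=> i j; apply: trig_ext (ta (rshift 1 i) (rshift 1 j)) => t; rewrite !mxE.
  by exists P => t; rewrite PE.
exists a', v' => /=; split => //.
- by move=> t; rewrite -aE uE invu.
- exists P11, P12, P21, P22; split.
    by move=> t; rewrite -P11E -P12E -P21E -P22E submxK.
  apply/eqOP => i j; rewrite !ord1.
  have /eqOP/(_ (lshift s 0) 0) := col0.
  by congr eqjet; apply/funext => t; rewrite -?P11E ?colE ?col_mxEu ?mxE.
- by move=> t; rewrite -vE invu.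
- split; first by move=> t; rewrite !uE ref'.
  by apply: eqO_trans Uphi; apply: eqO_ext => t; rewrite uE.
Qed.

End FilterFactors.

(** * Orthogonal normalization and its converse *)

Section MainParts.
Variable R : realType.
Notation C := R[i].

Lemma smooth_mx_csd_fourier r (phi : 'I_r -> csdist R) :
    smooth_mx (csd_fourier_vec phi).
Proof.
move=> i j; rewrite (_ : (fun t => _) = csd_fourier (phi i)).
  by apply: smooth0T => n; exact: Cn_on_csd_fourier.
by apply/funext => t; rewrite mxE.
Qed.

Definition sqnorm r (x : 'cV[C]_r) : C := (x^t* *m x) 0 0.

Lemma euclid_normE r (x : 'cV[C]_r) : euclid_norm x ^+ 2 = sqnorm x.
Proof.
rewrite /euclid_norm sqrtCK /sqnorm mxE; apply: eq_bigr => i _.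
by rewrite !mxE normCK mulrC.
Qed.

Lemma sqnorm_gt0 r (x : 'cV[C]_r) : x != 0 -> 0 < sqnorm x.
Proof.
move=> x0; rewrite lt0r -euclid_normE /euclid_norm sqrtCK; apply/andP; split;
    last first.
  by apply: sumr_ge0 => i _; apply: exprn_ge0.
apply: contra x0 => /eqP h; apply/eqP/matrixP => i j; rewrite ord1 mxE.
have := @psumr_eq0P _ _ xpredT (fun i => `|x i 0| ^+ 2) _ h i isT.
move/(_ (fun i _ => exprn_ge0 2 (normr_ge0 _)))/eqP.
by rewrite sqrf_eq0 normr_eq0 => /eqP.
Qed.

Lemma smooth0_sqnorm r (F : R -> 'cV[C]_r) : smooth_mx F ->
    smooth0 (fun t => sqnorm (F t)).
Proof. by move=> sF; apply: (smooth_mxM (smooth_mx_adj sF) sF). Qed.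

Lemma invmx_adj r (A B : 'M[C]_r) : A *m B = 1%:M -> invmx (A^t*) = B^t*.
Proof. by move=> AB; apply: invmx_eq; rewrite -adjM (mulmx1C AB) adj1. Qed.

(** By refinement and the sum rule at 0 the function v phi is invariant under
    dilation by d up to O(|xi|^m), hence has the jet of the constant v(0)
    phi(0). *)
Lemma compatible_pairing d m s (a : l0 R (1 + s) (1 + s)) (v : l0 R 1 (1 + s))
    (phi : R -> 'cV[C]_(1 + s)) : (2 <= d)%N -> smooth_mx phi ->
  (forall t, phi (d%:R * t) = fourier a t *m phi t) -> sum_rules d m a v ->
  fourier v 0 *m phi 0 = 1%:M ->
  eqO m (fun t => fourier v t *m phi t) (fun=> 1%:M).
Proof.
move=> d2 sphi ref [_ sr _] v0.
have sv := smooth_mx_fourier v; have sa := smooth_mx_fourier a.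
have svphi : smooth_mx (fun t => fourier v t *m phi t) by exact: smooth_mxM.
apply/eqOP => i j; rewrite !ord1.
have -> : (fun t : R => (1%:M : 'M[C]_1) 0 0) = fun=> 1.
  by apply/funext => t; rewrite mxE eqxx.
apply: (dilation_invariant_jet d2 (svphi 0 0)); first by rewrite v0 mxE eqxx.
have h : eqO m (fun t => fourier v (d%:R * t) *m phi (d%:R * t))
    (fun t => fourier v t *m phi t).
  apply: (@eqO_trans _ _ _ _ (fun t => (fourier v (d%:R * t) *m fourier a t) *m
      phi t)).
    by apply: eqO_ext => t; rewrite ref mulmxA.
  by apply: eqOMr => //; apply: smooth_mxM => //; exact: (smooth_mx_dilate d%:R sv).
by have /eqOP/(_ 0 0) := h.
Qed.

Lemma adj_e1 s : (col_mx 1%:M 0 : 'cV[C]_(1 + s))^t* = row_mx 1%:M 0.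
Proof. by rewrite adj_col adj1 adj0. Qed.

Lemma row0_mul s (H : 'M[C]_(1 + s)) j : ((row_mx 1%:M 0 : 'rV_(1 + s)) *m H) 0 j =
    H (lshift s 0) j.
Proof. by rewrite -[in LHS](vsubmxK H) mul_row_col mul1mx mul0mx addr0 mxE. Qed.

Lemma ord0_lshift s : (ord0 : 'I_(1 + s)) = lshift s 0.
Proof. exact: val_inj. Qed.

(** Let W0 have first column phi modulo O(|xi|^N). Gram-Schmidt on its columns
    keeps the first one and produces W with W^* W diagonal. Then v W = phi^* W
    / |phi|^2 = e_1^T (W^* W) / |phi|^2 = e_1^T, all modulo O(|xi|^m):
    normalizing phi normalizes v. *)
Lemma exists_orthogonal_normalization m n s (v : R -> 'rV[C]_(1 + s))
    (phi : R -> 'cV[C]_(1 + s)) :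
  (0 < s)%N -> smooth_mx v -> smooth_mx phi -> phi 0 != 0 ->
  eqO m v (fun t => (sqnorm (phi t))^-1 *: (phi t)^t*) ->
  exists U W : 'M[{poly C}]_(1 + s), [/\ U *m W = 1%:M,
    eqO n (fun t => zevalmx U t *m phi t) (fun=> col_mx 1%:M 0),
    eqO m (fun t => v t *m zevalmx W t) (fun=> row_mx 1%:M 0) &
    eqO (maxn m n) (fun t => (zevalmx W t)^t* *m zevalmx W t)
      (fun t => diag_mx (\row_(j < 1 + s) if j == ord0 then sqnorm (phi t)
                           else sqnorm (col j (zevalmx W t))))].
Proof.
move=> s0 sv sphi phi0 dual; set N := maxn m n.
have [U0 [W0 [UW0 Ue]]] := reduce_to_e1 N s0 sphi phi0.
pose G t := (zevalmx W0 t)^t* *m zevalmx W0 t.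
have sW0 := @smooth_mx_zevalmx _ _ _ W0.
have [|||T [S [TS Te off]]] := @gram_schmidt _ N s G.
- by apply: smooth_mxM => //; exact: smooth_mx_adj.
- by move=> t; rewrite /G adjM adjK.
- move=> x x0; rewrite /G mulmxA -(mulmxA (_ *m _)) -adjM; apply: sqnorm_gt0.
  apply: contra x0 => /eqP h; have : zevalmx U0 0 *m (zevalmx W0 0 *m x) = 0
      by rewrite h mulmx0.
  by rewrite mulmxA -zevalmxM UW0 zevalmx1 mul1mx => /eqP.
pose U := S *m U0; pose W := W0 *m T.
have UW : U *m W = 1%:M by apply: inverse_mul => //; exact: mulmx1C.
have WU t : zevalmx W t *m zevalmx U t = 1%:M
    by rewrite -zevalmxM (mulmx1C UW) zevalmx1.
have Se : S *m col_mx 1%:M 0 = col_mx 1%:M 0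
    by rewrite -{1}Te mulmxA (mulmx1C TS) mul1mx.
have pe1 (t : R) : zevalmx (col_mx 1%:M 0 : 'cV[{poly C}]_(1 + s)) t = col_mx 1%:M 0.
  by rewrite /zevalmx map_col_mx map_mx1 map_mx0.
have sU := @smooth_mx_zevalmx _ _ _ U; have sW := @smooth_mx_zevalmx _ _ _ W.
have sc := @smooth_mx_const R.
have sUphi : smooth_mx (fun t => zevalmx U t *m phi t) by exact: smooth_mxM.
have Uphi : eqO N (fun t => zevalmx U t *m phi t) (fun=> col_mx 1%:M 0).
  apply: (@eqO_trans _ _ _ _ (fun t => zevalmx S t *m (zevalmx U0 t *m phi t))).
    by apply: eqO_ext => t; rewrite zevalmxM mulmxA.
  apply: (@eqO_trans _ _ _ _ (fun t => zevalmx S t *m col_mx 1%:M 0)).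
    by apply: eqOMl => //; [exact: smooth_mx_zevalmx | apply: smooth_mxM => //;
        exact: smooth_mx_zevalmx].
  by apply: eqO_ext => t; rewrite -[in LHS](pe1 t) -zevalmxM Se pe1.
have We : eqO N (fun t => zevalmx W t *m col_mx 1%:M 0) phi.
  apply: (@eqO_trans _ _ _ _ (fun t => zevalmx W t *m (zevalmx U t *m phi t))).
    by apply: eqOMl => //; exact: eqO_sym.
  by apply: eqO_ext => t; rewrite mulmxA WU mul1mx.
pose H t := (zevalmx W t)^t* *m zevalmx W t.
have HE t : H t = (zevalmx T t)^t* *m G t *m zevalmx T t.
  by rewrite /H /W zevalmxM adjM /G !mulmxA.
have offH i j : i != j -> eqjet N (fun t => H t i j) (fun=> 0).
  move=> ij; rewrite (_ : (fun t => _) = fun t =>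
      ((zevalmx T t)^t* *m G t *m zevalmx T t) i j).
    exact: off.
  by apply/funext => t; rewrite HE.
have sWe : smooth_mx (fun t => zevalmx W t *m (col_mx 1%:M 0 : 'cV_(1 + s)))
    by exact: smooth_mxM.
(* The corner entry is the squared norm of the first column W e_1. *)
have H00 : eqjet N (fun t => H t (lshift s 0) (lshift s 0)) (fun t => sqnorm (phi t)).
  have /eqOP/(_ 0 0) := eqOM (smooth_mx_adj sWe) (smooth_mx_adj sphi) sWe sphi
      (eqO_adj sWe sphi We) We.
  congr eqjet; apply/funext => t.
  rewrite adjM adj_e1 mulmxA -(mulmxA (row_mx _ _)) -/(H t).
  rewrite -[in LHS](hsubmxK (row_mx 1%:M 0 *m H t)) mul_row_col mulmx1 mulmx0 addr0.
  by rewrite mxE row0_mul.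
exists U, W; split => //.
- exact: (eqO_le (leq_maxr m n) Uphi).
- have sn := smooth0_sqnorm sphi.
  have n0 : sqnorm (phi 0) != 0 by apply/lt0r_neq0/sqnorm_gt0.
  have sni := smooth0V sn n0.
  have mN := leq_maxl m n.
  have sWa := smooth_mx_adj sWe; have spa := smooth_mx_adj sphi.
  have snp : smooth_mx (fun t => (sqnorm (phi t))^-1 *: (phi t)^t*)
      by exact: smooth_mxZ.
  have sH : smooth_mx H by apply: smooth_mxM => //; exact: smooth_mx_adj.
  apply: (@eqO_trans _ _ _ _ (fun t => ((sqnorm (phi t))^-1 *: (phi t)^t*) *m
      zevalmx W t)).
    exact: eqOMr.
  apply: (@eqO_trans _ _ _ _ (fun t =>
      ((sqnorm (phi t))^-1 *: (zevalmx W t *m col_mx 1%:M 0)^t*) *m zevalmx W t)).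
    apply: (eqOMr snp (smooth_mxZ sni sWa) sW).
    apply: (eqOZ sni sni spa sWa (@eqjet_refl _ m _)).
    exact: (eqO_sym (eqO_le mN (eqO_adj sWe sphi We))).
  apply: (@eqO_trans _ _ _ _ (fun t =>
      (sqnorm (phi t))^-1 *: (row_mx 1%:M 0 *m H t))).
    by apply: eqO_ext => t; rewrite -scalemxAl adjM adj_e1 /H mulmxA.
  have [V [oV V0 Vn _]] := smooth0_nonzero sn n0.
  apply: (@eqO_trans _ _ _ _ (fun t =>
      (sqnorm (phi t))^-1 *: (sqnorm (phi t) *: row_mx 1%:M 0))).
    have seH : smooth_mx (fun t => (row_mx 1%:M 0 : 'rV_(1 + s)) *m H t)
        by apply: smooth_mxM sH; exact: sc.
    have sne : smooth_mx (fun t =>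
        sqnorm (phi t) *: (row_mx 1%:M 0 : 'rV[C]_(1 + s))).
      by apply: smooth_mxZ sn _; exact: sc.
    apply: (eqOZ sni sni seH sne (@eqjet_refl _ m _)).
    apply: (eqO_le mN); apply/eqOP => i j; rewrite ord1.
    rewrite (_ : (fun t => _) = fun t => H t (lshift s 0) j); last first.
      by apply/funext => t; rewrite row0_mul.
    case: (split_ordP j) => j' ->.
      rewrite ord1; apply: eqjet_trans H00 _; apply: (@eqjet_ext _ setT) =>
          [||t _] //.
        exact: openT.
      by rewrite mxE row_mxEl mxE eqxx mulr1.
    have := offH (lshift s 0) (rshift 1 j') isT.
    congr eqjet; apply/funext => t; by rewrite mxE row_mxEr mxE mulr0.
  apply/eqOP => i j; apply: (@eqjet_ext _ V) => // t; rewrite inE => Vt.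
  by rewrite scalerA (mulVf (Vn t Vt)) scale1r.
apply/eqOP => i j; have [<-|ij] := eqVneq i j; last first.
  have := offH i j ij; congr eqjet; apply/funext => t.
  by rewrite !mxE (negbTE ij) mulr0n.
rewrite (_ : (fun t => (diag_mx _) i i) = fun t => if i == ord0 then sqnorm (phi t)
    else sqnorm (col i (zevalmx W t))); last first.
  by apply/funext => t; rewrite !mxE eqxx mulr1n.
case: (split_ordP i) => i' ->; first by rewrite ord1 ord0_lshift eqxx.
rewrite /=; apply: (@eqjet_ext _ setT) => [||t _] //; first exact: openT.
by rewrite /sqnorm !mxE; apply: eq_bigr => k _; rewrite !mxE.
Qed.


(** Write W = U^{-1}, so that W e_1 = phi. Then phi^* = e_1^T W^* = e_1^T (W^*
    W) U = |phi|^2 e_1^T U = |phi|^2 (v W) U = |phi|^2 v, all modulo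
    O(|xi|^m). *)
Lemma dual_of_orthogonal m s (v : R -> 'rV[C]_(1 + s)) (phi : R -> 'cV[C]_(1 + s))
    (U W : R -> 'M[C]_(1 + s)) :
  smooth_mx v -> smooth_mx phi -> smooth_mx U -> smooth_mx W -> phi 0 != 0 ->
      (forall t, U t *m W t = 1%:M) ->
  eqO m (fun t => U t *m phi t) (fun=> col_mx 1%:M 0) ->
  eqO m (fun t => v t *m W t) (fun=> row_mx 1%:M 0) ->
  eqO m (fun t => (W t)^t* *m W t)
      (fun t => diag_mx (\row_(j < 1 + s) if j == ord0 then sqnorm (phi t)
                           else sqnorm (col j (W t)))) ->
  eqO m v (fun t => (sqnorm (phi t))^-1 *: (phi t)^t*).
Proof.
move=> sv sphi sU sW phi0 UW Uphi vW orth.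
have WU t : W t *m U t = 1%:M by exact: mulmx1C.
have sc := @smooth_mx_const R.
have sn := smooth0_sqnorm sphi.
have n0 : sqnorm (phi 0) != 0 by apply/lt0r_neq0/sqnorm_gt0.
have sni := smooth0V sn n0.
have sUphi : smooth_mx (fun t => U t *m phi t) by exact: smooth_mxM.
have We : eqO m phi (fun t => W t *m col_mx 1%:M 0).
  apply: (@eqO_trans _ _ _ _ (fun t => W t *m (U t *m phi t))); last exact: eqOMl.
  by apply: eqO_ext => t; rewrite mulmxA WU mul1mx.
have sWe : smooth_mx (fun t => W t *m (col_mx 1%:M 0 : 'cV_(1 + s)))
    by exact: smooth_mxM.
have sWa := smooth_mx_adj sW; have sphia := smooth_mx_adj sphi; have sWea :=
    smooth_mx_adj sWe.
pose D t : 'M[C]_(1 + s) := diag_mx (\row_(j < 1 + s) if j == ord0 then sqnorm (phi t)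
                           else sqnorm (col j (W t))).
have sD : smooth_mx D.
  move=> i j; rewrite (_ : (fun t => _) = fun t => (if j == ord0 then sqnorm (phi t)
     else sqnorm (col j (W t))) * (i == j)%:R); last first.
    apply/funext => t; rewrite !mxE mulr_natr.
    by have [->|ij] := eqVneq i j; rewrite ?mulr0n.
  apply: smooth0M; last exact: smooth0_const.
  case: (j == ord0) => //; apply: smooth0_sqnorm => k l.
  rewrite (_ : (fun t => _) = fun t => W t k j); first exact: sW.
  by apply/funext => t; rewrite mxE.
have key : eqO m (fun t => (phi t)^t*) (fun t => sqnorm (phi t) *: v t).
  apply: (@eqO_trans _ _ _ _ (fun t => (W t *m col_mx 1%:M 0)^t*));
      first exact: eqO_adj.
  apply: (@eqO_trans _ _ _ _ (fun t => row_mx 1%:M 0 *m ((W t)^t* *m W t) *m U t)).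
    by apply: eqO_ext => t; rewrite adjM adj_e1 -!mulmxA WU mulmx1.
  apply: (@eqO_trans _ _ _ _ (fun t => row_mx 1%:M 0 *m D t *m U t)).
    have sWW : smooth_mx (fun t => (W t)^t* *m W t) by exact: smooth_mxM.
    have sr := @smooth_mx_const R _ _ (row_mx 1%:M 0 : 'rV_(1 + s)).
    exact: (eqOMr (smooth_mxM sr sWW) (smooth_mxM sr sD) sU (eqOMl sr sWW sD orth)).
  apply: (@eqO_trans _ _ _ _ (fun t => sqnorm (phi t) *: (row_mx 1%:M 0 *m U t))).
    apply: eqO_ext => t; rewrite scalemxAl; congr (_ *m _).
    apply/matrixP => i j; rewrite ord1 row0_mul [RHS]mxE /D mxE mxE.
    case: (split_ordP j) => j' ->.
      by rewrite ord1 eqxx ord0_lshift eqxx row_mxEl mxE eqxx mulr1n mulr1.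
    by rewrite row_mxEr mxE mulr0 mulr0n.
  have svW : smooth_mx (fun t => v t *m W t) by exact: smooth_mxM.
  apply: (@eqO_trans _ _ _ _ (fun t => sqnorm (phi t) *: ((v t *m W t) *m U t))).
    apply: eqOZ => //; do ?[exact: smooth_mxM]; apply: eqOMr => //; exact: eqO_sym.
  by apply: eqO_ext => t; rewrite -mulmxA WU mulmx1.
have [V [oV V0 Vn _]] := smooth0_nonzero sn n0.
apply: (@eqO_trans _ _ _ _ (fun t => (sqnorm (phi t))^-1 *: (sqnorm (phi t) *: v t))).
  apply/eqOP => i j; apply: (@eqjet_ext _ V) => // t; rewrite inE => Vt.
  by rewrite scalerA (mulVf (Vn t Vt)) scale1r.
by apply: eqOZ => //; [exact: smooth_mxZ | exact: eqO_sym].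
Qed.

End MainParts.

(* The converse is stated for the accuracies n >= m; for n < m a single U of
   accuracy n does not force [matching_dual].  Example with d = m = 2, n = 1, U = 1 and
   upsilon = [1, 0], z = e^{-i xi}:
   a = [[z^-1 ((1 + z) / 2)^2, 0], [1 - z, 0]]. *)
Theorem theorem1p4 (R : realType) (d m s : nat)
    (a : l0 R (1 + s) (1 + s)) (phi : 'I_(1 + s) -> csdist R)
    (upsilon : l0 R 1 (1 + s))
    (hd : (2 <= d)%N) (hm : (0 < m)%N) (hr : (2 <= 1 + s)%N)
    (hrefine : forall xi : R,
       csd_fourier_vec phi (d%:R * xi) =
       fourier a xi *m csd_fourier_vec phi xi)
    (hphi0 : csd_fourier_vec phi 0 != 0)
    (hsum : sum_rules d m a upsilon)
    (hdual0 : fourier upsilon 0 *m csd_fourier_vec phi 0 = 1%:M) :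
  [/\ (* (i) *)
      forall n : nat, (0 < n)%N ->
        exists U : l0 R (1 + s) (1 + s),
          strongly_invertible U /\
          normal_form d m n a upsilon (csd_fourier_vec phi) U,
      (* (ii) *)
      matching_dual m upsilon (csd_fourier_vec phi) ->
      forall n : nat, (0 < n)%N ->
        exists U : l0 R (1 + s) (1 + s),
          [/\ strongly_invertible U,
              normal_form d m n a upsilon (csd_fourier_vec phi) U
            & almost_orthogonal m n (csd_fourier_vec phi) U]
    & (* converse *)
      forall n : nat, (m <= n)%N ->
        (exists U : l0 R (1 + s) (1 + s),
          [/\ strongly_invertible U,
              normal_form d m n a upsilon (csd_fourier_vec phi) U
            & almost_orthogonal m n (csd_fourier_vec phi) U]) ->
        matching_dual m upsilon (csd_fourier_vec phi)].
Proof.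
have s0 : (0 < s)%N by [].
have sphi := smooth_mx_csd_fourier phi; have sv := smooth_mx_fourier upsilon.
have inv_pair U W (u : l0 R (1 + s) (1 + s)) : U *m W = 1%:M ->
    (forall t, zevalmx U t = fourier u t) ->
    strongly_invertible u /\ forall t, invmx (fourier u t) = zevalmx W t.
  move=> UW uE; have UWt t : fourier u t *m zevalmx W t = 1%:M.
    by rewrite -uE -zevalmxM UW zevalmx1.
  have iu t := invmx_eq (UWt t); split => //; split.
    by move=> t; have [] := mulmx1_unit (UWt t).
  by have [w wE] := zevalmx_is_fourier W; exists w => t; rewrite iu wE.
have dualE : matching_dual m upsilon (csd_fourier_vec phi) <->
    eqO m (fourier upsilon) (fun t =>
        (sqnorm (csd_fourier_vec phi t))^-1 *: (csd_fourier_vec phi t)^t*).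
  rewrite /matching_dual; have -> // :
      (fun xi => (euclid_norm (csd_fourier_vec phi xi) ^+ 2)^-1
      *: (csd_fourier_vec phi xi)^t*) = fun t =>
          (sqnorm (csd_fourier_vec phi t))^-1 *: (csd_fourier_vec phi t)^t*.
  by apply/funext => t; rewrite euclid_normE.
split.
- move=> n n0; have [U [W [UW Uphi vW]]] := exists_normalization n s0 sv sphi hphi0
    (compatible_pairing hd sphi hrefine hsum hdual0).
  have [u uE] := zevalmx_is_fourier U; have [siu _] := inv_pair U W u UW uE.
  by exists u; split => //; apply: (normal_form_of_normalization hd sphi UW).
- move=> /dualE dual n n0.
  have [U [W [UW Uphi vW orth]]] :=
      exists_orthogonal_normalization n s0 sv sphi hphi0 dual.
  have [u uE] := zevalmx_is_fourier U; have [siu iu] := inv_pair U W u UW uE.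
  exists u; split => //; first exact: (normal_form_of_normalization hd sphi UW).
  have UWt t : fourier u t *m zevalmx W t = 1%:M by rewrite -uE -zevalmxM UW zevalmx1.
  apply: (eqO_trans _ (eqO_trans orth _)); apply: eqO_ext => t.
    by rewrite iu (invmx_adj (UWt t)).
  congr diag_mx; apply/matrixP => i j; rewrite !mxE iu !euclid_normE.
  by [].
- move=> n mn [u [[uu [w wE]] [a' [v' [_ _ vE [_ Uphi] [_ ve]]]] orth]]; apply/dualE.
  have uw t : fourier u t *m fourier w t = 1%:M by rewrite -wE mulmxV.
  apply: (dual_of_orthogonal sv sphi (smooth_mx_fourier u)
      (smooth_mx_fourier w) hphi0 uw).
  + exact: eqO_le Uphi.
  + by apply: eqO_trans ve; apply: eqO_ext => t; rewrite vE wE.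
  + apply: (eqO_trans _ (eqO_trans (eqO_le (leq_maxl m n) orth) _));
      apply: eqO_ext => t.
      by rewrite (invmx_adj (uw t)) wE.
    by congr diag_mx; apply/matrixP => i j; rewrite !mxE wE !euclid_normE.
Qed.
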